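(* Let $(X_i)_{i\in\mathbb{N}}$ be a sequence of free identically distributed self-adjoint random variables with distribution $\mu$ for some probability measure $\mu$ on $\mathbb{R}$. Assume that $\mu$ has mean zero, unit variance, and finite fourth moment. For $\theta=(\theta_1,\dots,\theta_n)\in\mathbb{S}^{n-1}$ denote by $\mu_\theta$ the distribution of $S_\theta=\theta_1X_1+\dots+\theta_nX_n$. Let $\rho\in(0,1)$. Then there exist constants $n_{\rho,\mu}\in\mathbb{N}$ and $C_{\rho,\mu}>0$ (not depending on $n$) and, for each $n$, a measurable set $\mathcal{F}=\mathcal{F}_n\subset\mathbb{S}^{n-1}$ with $\sigma_{n-1}(\mathcal{F})\ge 1-\rho$ such that for all $n\ge n_{\rho,\mu}$ and all $\theta\in\mathcal{F}$ we have $$\Delta(\mu_\theta,\omega)\le\frac{C_{\rho,\mu}}{\sqrt n}.$$ The constant $C_{\rho,\mu}$ depends on $\rho$ and on $\mu$ through its third and fourth absolute moments.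
   Context: $\mathbb{S}^{n-1}$ is the unit sphere of $\mathbb{R}^n$ (so $\theta_1^2+\dots+\theta_n^2=1$) and $\sigma_{n-1}$ is the uniform probability measure on it. $\omega$ is Wigner's semicircle law with mean zero and variance one, i.e. the measure with density $\frac{1}{2\pi}\sqrt{4-x^2}$ on $[-2,2]$. The Kolmogorov distance of probability measures $\nu_1,\nu_2$ on $\mathbb{R}$ is $\Delta(\nu_1,\nu_2)=\sup_{x\in\mathbb{R}}|\nu_1((-\infty,x])-\nu_2((-\infty,x])|$. The $X_i$ are (possibly unbounded) self-adjoint random variables in a tracial noncommutative probability space, free in Voiculescu's sense. The distribution of $S_\theta$ is the free additive convolution $\mu_\theta=\mu_1\boxplus\dots\boxplus\mu_n$, where $\mu_i=D_{\theta_i}\mu$ is the push-forward of $\mu$ under $x\mapsto\theta_i x$. Analytically, with $G_\nu(z)=\int\frac{1}{z-t}\nu(dt)$ and $F_\nu=1/G_\nu$ on the upper half-plane $\mathbb{C}^+$, the measure $\nu=\nu_1\boxplus\dots\boxplus\nu_n$ is the probability measure with $F_\nu(z)=F_{\nu_1}(Z_1(z))$, where $Z_1,\dots,Z_n:\mathbb{C}^+\to\mathbb{C}^+$ are the unique holomorphic functions with $Z_1(z)+\dots+Z_n(z)-z=(n-1)F_{\nu_1}(Z_1(z))$ and $F_{\nu_1}(Z_1(z))=\dots=F_{\nu_n}(Z_n(z))$ for all $z\in\mathbb{C}^+$. *)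

(* Defs.v *)
From HB Require Import structures.
From mathcomp Require Import all_boot all_order all_algebra.
From mathcomp Require Import all_classical all_reals all_analysis.
From mathcomp Require Import measurable_realfun complex.
From mathcomp Require Import lra ring.

Set Implicit Arguments.
Unset Strict Implicit.
Unset Printing Implicit Defensive.

Import Order.TTheory GRing.Theory Num.Theory.
Import numFieldNormedType.Exports.

Local Open Scope classical_set_scope.
Local Open Scope ring_scope.
Local Open Scope complex_scope.

Section semicircle.
Context {R : realType}.

(* No restriction to [-2, 2] is needed: Num.sqrt is 0 on negative numbers. *)
Definition semicircle_pdf (x : R) : R := Num.sqrt (4 - x ^+ 2) / (2 * pi).

Definition semicircle (V : set R) : \bar R :=
  (\int[lebesgue_measure]_(x in V) (semicircle_pdf x)%:E)%E.

Lemma semicircle_pdf_ge0 x : 0 <= semicircle_pdf x.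
Proof. by rewrite divr_ge0 ?sqrtr_ge0// mulr_ge0// pi_ge0. Qed.

Lemma continuous_semicircle_pdf : continuous semicircle_pdf.
Proof.
move=> x; apply: cvgM; last exact: cvg_cst.
apply: (@continuous_comp _ _ _ (fun x : R => 4 - x ^+ 2) Num.sqrt); last first.
  exact: sqrt_continuous.
by apply: cvgB; [exact: cvg_cst|exact: exprn_continuous].
Qed.

Lemma measurable_semicircle_pdf : measurable_fun setT semicircle_pdf.
Proof. by apply: continuous_measurable_fun; exact: continuous_semicircle_pdf. Qed.

Lemma integral_semicircle_pdf :
  (\int[lebesgue_measure]_x (semicircle_pdf x)%:E = 1)%E.
Proof.
have pi0 : (0 : R) < pi := pi_gt0 R.
transitivity (\int[lebesgue_measure]_(x in `[(-2 : R)%R, (2 : R)%R]) (semicircle_pdf x)%:E)%E.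
  rewrite [RHS]integral_mkcond; apply: eq_integral => x _; rewrite patchE.
  case: ifPn => // /negP; rewrite inE/= in_itv/= => xN2.
  rewrite /semicircle_pdf ler0_sqrtr ?mul0r// leNgt; apply/negP => h.
  by apply: xN2; apply/andP; split; nra.
pose F (t : R) := 2 * sin t.
have dF (t : R) : is_derive t 1 F (2 * cos t) by rewrite /F; apply: is_deriveZ.
have F'E : (F^`())%classic = (fun t => 2 * cos t).
  by apply/funext => t; rewrite derive1E; exact: derive_val.
have ccos : continuous (fun t : R => 2 * cos t).
  by move=> t; apply: cvgM; [exact: cvg_cst|exact: continuous_cos].
have csin : continuous F.
  by move=> t; apply: cvgM; [exact: cvg_cst|exact: continuous_sin].
have F1 : F (- (pi / 2)) = - 2 by rewrite /F sinN sin_pihalf mulrN1.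
have F2 : F (pi / 2) = 2 by rewrite /F sin_pihalf mulr1.
rewrite -[in X in `[X, _]]F1 -[in X in `[_, X]]F2.
rewrite integration_by_substitution_increasing; first last.
- by apply: continuous_subspaceT; exact: continuous_semicircle_pdf.
- split.
  + by move=> t _; apply: ex_derive.
  + by apply: cvg_at_right_filter; exact: csin.
  + by apply: cvg_at_left_filter; exact: csin.
- by rewrite F'E; apply/cvg_ex; eexists; apply: cvg_at_left_filter; exact: ccos.
- by rewrite F'E; apply/cvg_ex; eexists; apply: cvg_at_right_filter; exact: ccos.
- by rewrite F'E => t _; exact: ccos.
- by move=> s t sI tI st; rewrite /F ltr_pM2l// ltr_sin.
- lra.
pose g (t : R) := 2 * cos t ^+ 2 / pi.
transitivity (\int[lebesgue_measure]_(t in `[(- (pi / 2))%R, (pi / 2)%R]) (g t)%:E)%E.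
  apply: eq_integral => t; rewrite inE/= in_itv/= => /andP[t1 t2].
  have c0 : 0 <= cos t by apply: cos_ge0_pihalf; rewrite t1 t2.
  rewrite F'E/= /semicircle_pdf /F !fctE; congr EFin.
  have -> : 4 - (2 * sin t) ^+ 2 = (2 * cos t) ^+ 2.
    by rewrite exprMn sin2cos2; ring.
  rewrite sqrtr_sqr ger0_norm ?mulr_ge0// /g.
  by move: (cos t) (@pi R) pi0 => c p p0; field; rewrite gt_eqF.
pose H (t : R) := (t + sin t * cos t) / pi.
have dH (t : R) : is_derive t 1 H (g t).
  rewrite /H; apply: is_derive_eq.
  rewrite /g; have h := sin2cos2 t; rewrite /GRing.scale/=; move: h; rewrite !expr2.
  by move: (cos t) (sin t) (@pi R) pi0 => c s p p0 h; field: h; rewrite gt_eqF.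
have cH : continuous H.
  by move=> t; apply/differentiable_continuous/derivable1_diffP; exact: ex_derive.
rewrite (@continuous_FTC2 _ g H).
- rewrite /H sinN cosN cos_pihalf !mulr0 !addr0 -EFinB; congr EFin.
  by move: (@pi R) pi0 => p p0; field; rewrite gt_eqF.
- lra.
- apply: continuous_subspaceT => t; apply: cvgM; last exact: cvg_cst.
  apply: cvgM; first exact: cvg_cst.
  apply: (@continuous_comp _ _ _ (@cos R) (fun x => x ^+ 2)).
    exact: continuous_cos.
  exact: exprn_continuous.
- split.
  + by move=> t _; apply: ex_derive.
  + by apply: cvg_at_right_filter; exact: cH.
  + by apply: cvg_at_left_filter; exact: cH.
- by move=> t _; rewrite derive1E; exact: derive_val.
Qed.

Lemma integrable_semicircle_pdf :
  lebesgue_measure.-integrable [set: R] (fun x => (semicircle_pdf x)%:E).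
Proof.
apply/integrableP; split.
  by apply/measurable_EFinP; exact: measurable_semicircle_pdf.
under eq_integral do rewrite /= ger0_norm ?semicircle_pdf_ge0//.
by rewrite integral_semicircle_pdf ltry.
Qed.

Let semicircle0 : semicircle set0 = 0%E.
Proof. by rewrite /semicircle integral_set0. Qed.

Let semicircle_ge0 A : (0 <= semicircle A)%E.
Proof. by apply: integral_ge0 => x _; rewrite lee_fin semicircle_pdf_ge0. Qed.

Let semicircle_sigma_additive : semi_sigma_additive semicircle.
Proof.
move=> /= A mA tA mUA; rewrite /semicircle integral_bigcup//=; last first.
  by apply: (integrableS _ _ (subsetT _)) => //; exact: integrable_semicircle_pdf.
apply: is_cvg_ereal_nneg_natsum_cond => n _ _.
by apply: integral_ge0 => /= x ?; rewrite lee_fin semicircle_pdf_ge0.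
Qed.

HB.instance Definition _ := isMeasure.Build _ _ _
  semicircle semicircle0 semicircle_ge0 semicircle_sigma_additive.

Let semicircle_setT : semicircle [set: _] = 1%E.
Proof. exact: integral_semicircle_pdf. Qed.

HB.instance Definition _ :=
  @Measure_isProbability.Build _ _ R semicircle semicircle_setT.

End semicircle.

Section kolmogorov.
Context {R : realType}.
Local Open Scope ereal_scope.

Definition kolmogorov (nu1 nu2 : probability R R) : \bar R :=
  ereal_sup [set `|nu1 `]-oo, x]%classic - nu2 `]-oo, x]%classic|
            | x in [set: R]].

End kolmogorov.

Section dilation.
Context {R : realType}.

Definition scale (c : R) (x : R) : R := c * x.

Lemma measurable_scale (c : R) : measurable_fun [set: R] (scale c).
Proof. exact: measurable_funM. Qed.

HB.instance Definition _ (c : R) :=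
  isMeasurableFun.Build _ _ _ _ (scale c) (@measurable_scale c).

Definition dilation (c : R) (mu : probability R R) : probability R R :=
  distribution mu (scale c).

End dilation.

Section free_convolution.
Context {R : realType}.
Implicit Types (nu : probability R R) (z : R[i]).

Definition cauchy_transform nu z : R[i] :=
  (\int[nu]_t complex.Re (z - t%:C)^-1) +i*
  (\int[nu]_t complex.Im (z - t%:C)^-1).

Definition reciprocal_cauchy_transform nu z : R[i] :=
  (cauchy_transform nu z)^-1.

Local Notation F := reciprocal_cauchy_transform.

Definition upper_half_plane : set R[i] := [set z | 0 < complex.Im z].

(* [derivable] over the field R[i] is complex differentiability. *)
Definition holomorphic_on (D : set R[i]) (f : R[i] -> R[i]) : Prop :=
  forall z, D z -> derivable (f : R[i]^o -> R[i]^o) z 1.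

Definition is_subordination n (nus : 'I_n -> probability R R)
    (Z : 'I_n -> R[i] -> R[i]) : Prop :=
  [/\ forall i z, upper_half_plane z -> upper_half_plane (Z i z),
      forall i, holomorphic_on upper_half_plane (Z i),
      forall z, upper_half_plane z ->
        forall i, \sum_(j < n) Z j z - z = (n%:R - 1) * F (nus i) (Z i z)
    & forall z, upper_half_plane z ->
        forall i j, F (nus i) (Z i z) = F (nus j) (Z j z)].

(* [is_free_convolution nus nu] says that nu is the free additive convolution
   of nus 0, ..., nus (n - 1).  For n > 0 the subordination functions exist and
   are unique, and so is nu, because nu is determined by F nu on the upper
   half-plane. *)
Definition is_free_convolution n (nus : 'I_n -> probability R R) nu : Prop :=
  exists Z, is_subordination nus Z /\
    forall z, upper_half_plane z -> forall i, F nu z = F (nus i) (Z i z).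

End free_convolution.

Section sphere.
Context {R : realType} {n : nat}.

Definition sphere : set (n.-tuple R) :=
  [set theta | \sum_(i < n) tnth theta i ^+ 2 = 1].

Definition orthogonal_act (Q : 'M[R]_n) (theta : n.-tuple R) : n.-tuple R :=
  [tuple \sum_(j < n) Q i j * tnth theta j | i < n].

(* For n > 0 there is exactly one O(n)-invariant Borel probability measure
   on the sphere, so this predicate determines sigma. *)
Definition uniform_on_sphere (sigma : probability (n.-tuple R) R) : Prop :=
  sigma sphere = 1%E /\
  forall Q : 'M[R]_n, Q *m Q^T = 1%:M ->
  forall A : set (n.-tuple R), measurable A ->
    sigma (orthogonal_act Q @^-1` A) = sigma A.

End sphere.
Arguments sphere : clear implicits.

Definition abs_moment {R : realType} (mu : probability R R) (k : nat) : R :=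
  \int[mu]_x (`|x| ^+ k).

(* Main.v *)
Require Import Defs.
From HB Require Import structures.
From mathcomp Require Import all_boot all_order all_algebra.
From mathcomp Require Import all_classical all_reals all_analysis.
From mathcomp Require Import measurable_realfun complex.
From mathcomp Require Import lra ring.

Set Implicit Arguments.
Unset Strict Implicit.
Unset Printing Implicit Defensive.

Import Order.TTheory GRing.Theory Num.Theory.
Import numFieldNormedType.Exports.

Local Open Scope classical_set_scope.
Local Open Scope ring_scope.
Local Open Scope complex_scope.

(** Write [G], [F = 1 / G] for the Cauchy transform of [mu_theta] and its
    reciprocal, and [G_i], [F_i] for those of the dilation of [mu] by [theta_i].
    With the subordination functions [Z_i], so that [F = F_i (Z_i)], the defining
    relation reads [z - F = \sum_i (Z_i - F)].

    Since [mu] is centered with variance one, [Z_i - F_i (Z_i)] is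
    [theta_i^2 / F] up to an error of order [theta_i^4 / Im z + |theta_i|^3]; this
    uses the Cauchy transform up to the fourth moment, and a lower bound on [|F|]
    ([summand_remainder]).  As [\sum_i theta_i^2 = 1], summation yields the
    perturbed semicircle equation [F + 1 / F = z + O(Lambda)] at heights
    [Im z >= 8 Lambda] ([self_consistent_equation]), where [Lambda^2] bounds
    [\sum_i theta_i^4].  The lower bound on [|F|] is obtained simultaneously, by
    continuity from [Im z = 1] downwards ([cmod_cauchy_le4]).

    On the sphere [\sum_i theta_i^4] has mean [3 / (n + 2)], because invariance under
    the isometry [(x, y) -> (x + y, x - y) / sqrt 2] of a coordinate plane forces
    [E theta_i^4 + E theta_j^4 = 6 E theta_i^2 theta_j^2].  By Markov's inequality
    [Lambda = O(n^(-1/2))] outside a set of measure at most [rho]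
    ([sphere_quartic_small]).

    To pass from the equation to distribution functions, [G] is compared directly
    with the boundary value [s = sin t - i cos t] of the semicircle transform at
    [x = 2 sin t], the height being one more perturbation of the equation
    [s + 1 / s = x].  The difference is at most [O(Lambda) / cos t]
    ([semicircle_stability]), and the singular factor is the inverse of the
    Jacobian [d x / d t = 2 cos t], so the distribution functions of [mu_theta]
    smoothed by a Cauchy law and of the semicircle law have increments over
    [-2, 2] that differ by [O(Lambda)] ([smoothed_cdf_local_law]).  The smoothing
    is removed without logarithmic loss by combining the scales [v] and [2 v]
    ([smoothed_cdf_gap]), and outside [-2, 2] nothing is left to prove, since the
    semicircle law has all its mass inside ([kolmogorov_local_law]). *)

(** * Complex modulus and expectations *)

Section complex_modulus.
Context {R : realType}.
Implicit Types (z w : R[i]).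

(** The norm of [R[i]] takes values in [R[i]]; this is its real-valued version,
    on which real linear arithmetic is available. *)
Definition cmod z : R := Num.sqrt (complex.Re z ^+ 2 + complex.Im z ^+ 2).

Lemma cmodE z : `|z| = (cmod z)%:C. Proof. by case: z. Qed.

Lemma cmod_ge0 z : 0 <= cmod z. Proof. exact: sqrtr_ge0. Qed.

Lemma cmod_sqr z : cmod z ^+ 2 = complex.Re z ^+ 2 + complex.Im z ^+ 2.
Proof. by rewrite sqr_sqrtr// addr_ge0// sqr_ge0. Qed.

Lemma cmodM z w : cmod (z * w) = cmod z * cmod w.
Proof. by apply: complexI; rewrite rmorphM/= -!cmodE normrM. Qed.

Lemma cmodX z n : cmod (z ^+ n) = cmod z ^+ n.
Proof. by apply: complexI; rewrite rmorphXn/= -!cmodE normrX. Qed.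

Lemma cmodV z : cmod z^-1 = (cmod z)^-1.
Proof. by apply: complexI; rewrite fmorphV/= -!cmodE normfV. Qed.

Lemma cmodN z : cmod (- z) = cmod z.
Proof. by apply: complexI; rewrite -!cmodE normrN. Qed.

Lemma cmodD z w : cmod (z + w) <= cmod z + cmod w.
Proof. by rewrite -lecR rmorphD/= -!cmodE ler_normD. Qed.

Lemma cmodB z w : cmod (z - w) <= cmod z + cmod w.
Proof. by rewrite -[cmod w]cmodN cmodD. Qed.

Lemma ler_dist_cmod z w : `|cmod z - cmod w| <= cmod (z - w).
Proof.
have := cmodD w (z - w); have := cmodB z (z - w).
rewrite subKr subrKC => h1 h2; rewrite ler_norml; apply/andP; split; lra.
Qed.

Lemma cmod_sum n (f : 'I_n -> R[i]) :
  cmod (\sum_(i < n) f i) <= \sum_(i < n) cmod (f i).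
Proof.
elim/big_ind2 : _ => [|x x' y y' hx hy|//]; last first.
  by rewrite (le_trans (cmodD _ _))// lerD.
by rewrite /cmod/= expr0n/= addr0 sqrtr0.
Qed.

Lemma cmodC (x : R) : cmod x%:C = `|x|.
Proof. by rewrite /cmod/= expr0n/= addr0 sqrtr_sqr. Qed.

Lemma cmod_eq0 z : (cmod z == 0) = (z == 0).
Proof. by rewrite -(inj_eq (@complexI R)) -cmodE normr_eq0. Qed.

Lemma cmod_gt0 z : (0 < cmod z) = (z != 0).
Proof. by rewrite lt_neqAle cmod_ge0 andbT eq_sym cmod_eq0. Qed.

Lemma ler_Im_cmod z : `|complex.Im z| <= cmod z.
Proof. by rewrite -sqrtr_sqr ler_wsqrtr// lerDr sqr_ge0. Qed.

Lemma ler_Re_cmod z : `|complex.Re z| <= cmod z.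
Proof. by rewrite -sqrtr_sqr ler_wsqrtr// lerDl sqr_ge0. Qed.

Lemma cmod_le_ReIm z : cmod z <= `|complex.Re z| + `|complex.Im z|.
Proof.
rewrite -(@ler_pXn2r _ 2)// ?nnegrE ?cmod_ge0// ?addr_ge0// cmod_sqr sqrrD.
have := mulr_ge0 (normr_ge0 (complex.Re z)) (normr_ge0 (complex.Im z)).
by rewrite !real_normK ?num_real//; lra.
Qed.

Lemma complexReD z w : complex.Re (z + w) = complex.Re z + complex.Re w.
Proof. by case: z; case: w. Qed.
Lemma complexImD z w : complex.Im (z + w) = complex.Im z + complex.Im w.
Proof. by case: z; case: w. Qed.
Lemma complexReN z : complex.Re (- z) = - complex.Re z.
Proof. by case: z. Qed.
Lemma complexImN z : complex.Im (- z) = - complex.Im z.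
Proof. by case: z. Qed.
Lemma complexReM z w :
  complex.Re (z * w) = complex.Re z * complex.Re w - complex.Im z * complex.Im w.
Proof. by case: z; case: w. Qed.
Lemma complexImM z w :
  complex.Im (z * w) = complex.Re z * complex.Im w + complex.Im z * complex.Re w.
Proof. by case: z; case: w. Qed.
Lemma complexReV z : complex.Re z^-1 = complex.Re z / cmod z ^+ 2.
Proof. by rewrite cmod_sqr; case: z. Qed.
Lemma complexImV z : complex.Im z^-1 = - complex.Im z / cmod z ^+ 2.
Proof. by rewrite cmod_sqr; case: z => a b /=; rewrite mulNr. Qed.
Lemma complex_eqP z w : complex.Re z = complex.Re w -> complex.Im z = complex.Im w -> z = w.
Proof. by case: z w => a b [c d]/= -> ->. Qed.

Lemma Im_sum n (f : 'I_n -> R[i]) :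
  complex.Im (\sum_(i < n) f i) = \sum_(i < n) complex.Im (f i).
Proof. by elim/big_ind2 : _ => // x x' y y' <- <-; rewrite complexImD. Qed.

Lemma upper_neq0 z : 0 < complex.Im z -> z != 0.
Proof. by apply: contraTneq => ->; rewrite /= ltxx. Qed.

End complex_modulus.

Section integration.
Context {R : realType} d {T : measurableType d} (mu : probability T R).
Implicit Types (f g : T -> R) (h k : T -> R[i]).

Definition has_mean f := mu.-integrable [set: T] (EFin \o f).

Lemma has_mean_dom f g : measurable_fun setT f ->
  (forall t, `|f t| <= g t) -> has_mean g -> has_mean f.
Proof.
move=> mf fg; apply: le_integrable => //; first exact/measurable_EFinP.
by move=> t _ /=; rewrite lee_fin (le_trans (fg t))// ler_norm.
Qed.

Lemma has_mean_cst (c : R) : has_mean (fun=> c).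
Proof. exact: finite_measure_integrable_cst. Qed.

Lemma has_meanD f g : has_mean f -> has_mean g -> has_mean (fun t => f t + g t).
Proof. by move=> hf hg; exact: (integrableD _ hf hg). Qed.

Lemma has_meanZ (c : R) f : has_mean f -> has_mean (fun t => c * f t).
Proof. by move=> hf; exact: (integrableZl _ c hf). Qed.

Lemma has_meanB f g : has_mean f -> has_mean g -> has_mean (fun t => f t - g t).
Proof.
move=> hf hg; have := has_meanD hf (has_meanZ (-1) hg).
by under eq_fun do rewrite mulN1r.
Qed.

Lemma has_mean_bounded (K : R) f : measurable_fun setT f ->
  (forall t, `|f t| <= K) -> has_mean f.
Proof. by move=> mf fK; exact: (has_mean_dom mf fK (has_mean_cst K)). Qed.

Lemma mean_cst (c : R) : \int[mu]_t c = c.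
Proof. by rewrite Rintegral_cst//=; rewrite (probability_setT mu) mulr1. Qed.

Lemma meanD f g : has_mean f -> has_mean g ->
  \int[mu]_t (f t + g t) = \int[mu]_t f t + \int[mu]_t g t.
Proof. by move=> hf hg; rewrite RintegralD. Qed.

Lemma meanB f g : has_mean f -> has_mean g ->
  \int[mu]_t (f t - g t) = \int[mu]_t f t - \int[mu]_t g t.
Proof. by move=> hf hg; rewrite RintegralB. Qed.

Lemma meanZ (c : R) f : has_mean f ->
  \int[mu]_t (c * f t) = c * \int[mu]_t f t.
Proof. by move=> hf; rewrite RintegralZl. Qed.

Lemma le_mean f g : has_mean f -> has_mean g -> (forall t, f t <= g t) ->
  \int[mu]_t f t <= \int[mu]_t g t.
Proof. by move=> hf hg fg; apply: le_Rintegral. Qed.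

Lemma norm_mean_le f g : has_mean f -> has_mean g -> (forall t, `|f t| <= g t) ->
  `|\int[mu]_t f t| <= \int[mu]_t g t.
Proof.
move=> hf hg fg; rewrite (le_trans (le_normr_Rintegral _ _))//.
by apply: le_mean => //; exact: integrable_norm.
Qed.

Definition cmean h : R[i] :=
  (\int[mu]_t complex.Re (h t)) +i* (\int[mu]_t complex.Im (h t)).

Definition has_cmean h :=
  has_mean (fun t => complex.Re (h t)) /\ has_mean (fun t => complex.Im (h t)).

Lemma has_cmeanC f : has_mean f -> has_cmean (fun t => (f t)%:C).
Proof. by split=> //=; exact: has_mean_cst. Qed.

Lemma has_cmeanD h k : has_cmean h -> has_cmean k ->
  has_cmean (fun t => h t + k t).
Proof.
move=> [h1 h2] [k1 k2]; split; under eq_fun do rewrite ?complexReD ?complexImD;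
by apply: has_meanD.
Qed.

Lemma has_cmeanZ (c : R[i]) h : has_cmean h -> has_cmean (fun t => c * h t).
Proof.
move=> [h1 h2]; split; under eq_fun do rewrite ?complexReM ?complexImM.
  by apply: has_meanB; apply: has_meanZ.
by apply: has_meanD; apply: has_meanZ.
Qed.

Lemma cmeanC f : cmean (fun t => (f t)%:C) = (\int[mu]_t f t)%:C.
Proof. by rewrite /cmean/= mean_cst. Qed.

Lemma cmeanD h k : has_cmean h -> has_cmean k ->
  cmean (fun t => h t + k t) = cmean h + cmean k.
Proof.
move=> [h1 h2] [k1 k2]; rewrite /cmean.
under eq_Rintegral do rewrite complexReD.
under [X in _ +i* X]eq_Rintegral do rewrite complexImD.
by rewrite !meanD.
Qed.

Lemma cmeanZ (c : R[i]) h : has_cmean h ->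
  cmean (fun t => c * h t) = c * cmean h.
Proof.
move=> [h1 h2]; rewrite /cmean.
under eq_Rintegral do rewrite complexReM.
under [X in _ +i* X]eq_Rintegral do rewrite complexImM.
rewrite meanB ?meanD ?meanZ//; try exact: has_meanZ.
by apply: complex_eqP; rewrite ?complexReM ?complexImM.
Qed.

Lemma eq_cmean h k : h =1 k -> cmean h = cmean k.
Proof. by move=> /funext ->. Qed.

(** The factor 2 comes from estimating real and imaginary parts separately. *)
Lemma cmod_cmean_le h f : has_cmean h -> has_mean f ->
  (forall t, cmod (h t) <= f t) -> cmod (cmean h) <= 2 * \int[mu]_t f t.
Proof.
move=> [h1 h2] hf le_hf; apply: le_trans (cmod_le_ReIm _) _ => /=.
rewrite mulr_natl mulr2n lerD//; apply: norm_mean_le => // t;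
  apply: le_trans (le_hf t).
  exact: ler_Re_cmod.
exact: ler_Im_cmod.
Qed.

End integration.

Section integration_sums.
Context {R : realType} d {T : measurableType d} (mu : probability T R).

Lemma has_mean_sum (I : Type) (r : seq I) (f : I -> T -> R) :
  (forall i, has_mean mu (f i)) -> has_mean mu (fun t => \sum_(i <- r) f i t).
Proof.
move=> hf; elim: r => [|i r IH].
  by under eq_fun do rewrite big_nil; exact: has_mean_cst.
by under eq_fun do rewrite big_cons; exact: has_meanD.
Qed.

Lemma mean_sum (I : Type) (r : seq I) (f : I -> T -> R) :
  (forall i, has_mean mu (f i)) ->
  \int[mu]_t \sum_(i <- r) f i t = \sum_(i <- r) \int[mu]_t f i t.
Proof.
move=> hf; elim: r => [|i r IH].
  by under eq_Rintegral do rewrite big_nil; rewrite mean_cst big_nil.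
under eq_Rintegral do rewrite big_cons.
by rewrite meanD// ?IH ?big_cons//; exact: has_mean_sum.
Qed.

End integration_sums.

(** * Cauchy transforms of dilated measures *)

Section resolvent_kernel.
Context {R : realType}.
Implicit Types (w : R[i]) (s t : R) (mu : probability R R).

Lemma Re_resolvent w s : complex.Re (w - s%:C)^-1 =
  (complex.Re w - s) / ((complex.Re w - s) ^+ 2 + complex.Im w ^+ 2).
Proof.
by rewrite complexReV cmod_sqr complexReD complexImD complexReN complexImN/= oppr0 addr0.
Qed.

Lemma Im_resolvent w s : complex.Im (w - s%:C)^-1 =
  - complex.Im w / ((complex.Re w - s) ^+ 2 + complex.Im w ^+ 2).
Proof.
by rewrite complexImV cmod_sqr complexReD complexImD complexReN complexImN/= oppr0 addr0.
Qed.

Lemma resolvent_neq0 w s : 0 < complex.Im w -> w - s%:C != 0.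
Proof. by move=> w0; rewrite upper_neq0// complexImD complexImN/= oppr0 addr0. Qed.

Lemma cmod_resolvent_sqr w s : 0 < complex.Im w ->
  cmod (w - s%:C)^-1 ^+ 2 = - complex.Im (w - s%:C)^-1 / complex.Im w.
Proof.
move=> w0; have h : cmod (w - s%:C) != 0 by rewrite cmod_eq0 resolvent_neq0.
 rewrite complexImV complexImD complexImN/= oppr0 addr0 cmodV.
by field; rewrite h gt_eqF.
Qed.

Lemma cmod_resolvent_le w s : 0 < complex.Im w ->
  cmod (w - s%:C)^-1 <= (complex.Im w)^-1.
Proof.
move=> w0; rewrite cmodV lef_pV2 ?posrE ?cmod_gt0 ?resolvent_neq0//.
have := ler_Im_cmod (w - s%:C); rewrite complexImD complexImN/= oppr0 addr0.
by apply: le_trans; exact: ler_norm.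
Qed.

Lemma measurable_Re_resolvent w (theta : R) : 0 < complex.Im w ->
  measurable_fun setT (fun t : R => complex.Re (w - (theta * t)%:C)^-1).
Proof.
move=> w0; under eq_fun do rewrite Re_resolvent.
apply: continuous_measurable_fun => t.
have ct : (fun t => complex.Re w - theta * t) @ t --> complex.Re w - theta * t.
  by apply: cvgB; [exact: cvg_cst|apply: cvgM; [exact: cvg_cst|exact: cvg_id]].
apply: cvgM => //; apply: cvgV.
  by rewrite gt_eqF// ltr_wpDl ?sqr_ge0 ?exprn_gt0.
by apply: cvgD; [exact: cvgM|exact: cvg_cst].
Qed.

Lemma measurable_Im_resolvent w (theta : R) : 0 < complex.Im w ->
  measurable_fun setT (fun t : R => complex.Im (w - (theta * t)%:C)^-1).
Proof.
move=> w0; under eq_fun do rewrite Im_resolvent.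
apply: continuous_measurable_fun => t.
have ct : (fun t => complex.Re w - theta * t) @ t --> complex.Re w - theta * t.
  by apply: cvgB; [exact: cvg_cst|apply: cvgM; [exact: cvg_cst|exact: cvg_id]].
apply: cvgM; first exact: cvg_cst; apply: cvgV.
  by rewrite gt_eqF// ltr_wpDl ?sqr_ge0 ?exprn_gt0.
by apply: cvgD; [exact: cvgM|exact: cvg_cst].
Qed.

Lemma has_cmean_resolvent mu w (theta : R) : 0 < complex.Im w ->
  has_cmean mu (fun t : R => (w - (theta * t)%:C)^-1).
Proof.
move=> w0; split; apply: (@has_mean_bounded _ _ _ _ (complex.Im w)^-1).
- exact: measurable_Re_resolvent.
- by move=> t; rewrite (le_trans (ler_Re_cmod _))// cmod_resolvent_le.
- exact: measurable_Im_resolvent.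
- by move=> t; rewrite (le_trans (ler_Im_cmod _))// cmod_resolvent_le.
Qed.

Lemma has_cmean_resolvent1 mu w : 0 < complex.Im w ->
  has_cmean mu (fun t : R => (w - t%:C)^-1).
Proof. by move=> /(has_cmean_resolvent mu 1); under eq_fun do rewrite mul1r. Qed.

Lemma mean_dilation mu (theta : R) (f : R -> R) (K : R) :
  measurable_fun setT f -> (forall t, `|f t| <= K) ->
  \int[dilation theta mu]_t f t = \int[mu]_t f (theta * t).
Proof.
move=> mf fK; rewrite /Rintegral; congr fine.
rewrite [LHS](@integral_pushforward _ _ _ _ _ (scale theta) _ mu) ?preimage_setT//.
- exact/measurable_EFinP.
- apply: (@has_mean_bounded _ _ _ mu K) => [|t]; last exact: fK.
  by apply: measurableT_comp => //; exact: measurable_scale.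
Qed.

Lemma cauchy_transform_dilation mu (theta : R) w : 0 < complex.Im w ->
  cauchy_transform (dilation theta mu) w =
  cmean mu (fun t => (w - (theta * t)%:C)^-1).
Proof.
move=> w0.
have := measurable_Re_resolvent 1 w0; have := measurable_Im_resolvent 1 w0.
under eq_fun do rewrite mul1r; move=> mIm.
under eq_fun do rewrite mul1r; move=> mRe.
rewrite /cauchy_transform /cmean; congr (_ +i* _);
  rewrite (@mean_dilation _ _ _ (complex.Im w)^-1)// => t.
- by rewrite (le_trans (ler_Re_cmod _))// cmod_resolvent_le.
- by rewrite (le_trans (ler_Im_cmod _))// cmod_resolvent_le.
Qed.

End resolvent_kernel.

Section bessel.
Context {R : realType} (mu : probability R R).
Hypothesis square_mean : has_mean mu (fun t : R => t ^+ 2).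
Hypothesis mean0 : \int[mu]_t t = 0.
Hypothesis var1 : \int[mu]_t t ^+ 2 = 1.

Lemma has_mean_id : has_mean mu (fun t : R => t).
Proof.
apply: (has_mean_dom (g := fun t : R => 1 + t ^+ 2)) => // [t|].
  by have := sqr_ge0 (`|t| - 2^-1); rewrite -[t ^+ 2]real_normK ?num_real//; nra.
exact: has_meanD (has_mean_cst _ _) _.
Qed.

(** Nonnegativity of the mean of [(a - g - c t)^2], where [g] and [c] are the
    coefficients of [a] along the orthonormal functions [1] and [t]. *)
Lemma bessel_1t (a : R -> R) (K : R) :
  measurable_fun setT a -> (forall t, `|a t| <= K) ->
  (\int[mu]_t a t) ^+ 2 + (\int[mu]_t (t * a t)) ^+ 2 <= \int[mu]_t a t ^+ 2.
Proof.
move=> ma aK.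
have K0 : 0 <= K := le_trans (normr_ge0 _) (aK 0).
have ha : has_mean mu a := has_mean_bounded _ ma aK.
have ha2 : has_mean mu (fun t => a t ^+ 2).
  apply: (@has_mean_bounded _ _ _ _ (K ^+ 2)) => [|t]; first exact: measurable_funX.
  by rewrite normrX lerXn2r ?nnegrE// (le_trans (normr_ge0 _) (aK t)).
have hta : has_mean mu (fun t => t * a t).
  apply: (has_mean_dom (g := fun t : R => K * `|t|)) => [|t|].
  - exact: measurable_funM.
  - by rewrite normrM mulrC ler_wpM2r.
  - by apply: has_meanZ; exact: (integrable_norm has_mean_id).
set g := \int[mu]_t a t; set c := \int[mu]_t (t * a t).
have : 0 <= \int[mu]_t (a t - g - c * t) ^+ 2.
  by apply: Rintegral_ge0 => t _; exact: sqr_ge0.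
have -> : \int[mu]_t (a t - g - c * t) ^+ 2 =
   \int[mu]_t (a t ^+ 2 + ((- 2 * g) * a t + ((- 2 * c) * (t * a t) +
       (g ^+ 2 + ((2 * g * c) * t + c ^+ 2 * t ^+ 2))))).
  by apply: eq_Rintegral => t _; ring.
have h1 := has_meanZ (2 * g * c) has_mean_id.
have h2 := has_meanZ (c ^+ 2) square_mean.
have h3 := has_meanD h1 h2.
have h4 := has_meanD (has_mean_cst mu (g ^+ 2)) h3.
have h5 := has_meanD (has_meanZ (- 2 * c) hta) h4.
have h6 := has_meanD (has_meanZ (- 2 * g) ha) h5.
rewrite !meanD ?meanZ ?mean_cst ?mean0 ?var1//;
  try exact: has_meanZ; try exact: has_mean_cst; try exact: has_mean_id.
rewrite -/g -/c; lra.
Qed.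

Let G (theta : R) (w : R[i]) := cmean mu (fun t => (w - (theta * t)%:C)^-1).

Let has_cmean_tk (theta : R) (w : R[i]) : 0 < complex.Im w ->
  has_cmean mu (fun t => t%:C * (w - (theta * t)%:C)^-1).
Proof.
move=> w0; split.
- under eq_fun do rewrite complexReM/= mul0r subr0.
  apply: (has_mean_dom (g := fun t : R => (complex.Im w)^-1 * `|t|)) => [|t|].
  + by apply: measurable_funM => //; exact: measurable_Re_resolvent.
  + rewrite normrM mulrC ler_wpM2r//.
    by rewrite (le_trans (ler_Re_cmod _))// cmod_resolvent_le.
  + by apply: has_meanZ; exact: (integrable_norm has_mean_id).
- under eq_fun do rewrite complexImM/= mul0r addr0.
  apply: (has_mean_dom (g := fun t : R => (complex.Im w)^-1 * `|t|)) => [|t|].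
  + by apply: measurable_funM => //; exact: measurable_Im_resolvent.
  + rewrite normrM mulrC ler_wpM2r//.
    by rewrite (le_trans (ler_Im_cmod _))// cmod_resolvent_le.
  + by apply: has_meanZ; exact: (integrable_norm has_mean_id).
Qed.

(** Bessel's inequality for the real and imaginary parts of the resolvent, whose
    squared [L^2] norm is [- Im G / Im w].  The coefficient on [t], multiplied by
    [theta], is [w G - 1] because [w / (w - theta t) - 1 = theta t / (w - theta t)]. *)
Lemma cmod_cauchy_bessel (theta : R) (w : R[i]) : 0 < complex.Im w ->
  cmod (G theta w) ^+ 2 <= - complex.Im (G theta w) / complex.Im w /\
  cmod (w * G theta w - 1) ^+ 2 <=
  theta ^+ 2 * (- complex.Im (G theta w) / complex.Im w - cmod (G theta w) ^+ 2).
Proof.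
move=> w0.
pose a t := complex.Re (w - (theta * t)%:C)^-1.
pose b t := complex.Im (w - (theta * t)%:C)^-1.
have ma : measurable_fun setT a := measurable_Re_resolvent theta w0.
have mb : measurable_fun setT b := measurable_Im_resolvent theta w0.
have aK t : `|a t| <= (complex.Im w)^-1.
  by rewrite (le_trans (ler_Re_cmod _))// cmod_resolvent_le.
have bK t : `|b t| <= (complex.Im w)^-1.
  by rewrite (le_trans (ler_Im_cmod _))// cmod_resolvent_le.
have hk := has_cmean_resolvent mu theta w0.
have [/= ha hb] := hk.
have h2 (f : R -> R) : measurable_fun setT f -> (forall t, `|f t| <= (complex.Im w)^-1) ->
    has_mean mu (fun t => f t ^+ 2).
  move=> mf fK; apply: (@has_mean_bounded _ _ _ _ ((complex.Im w)^-1 ^+ 2)) => [|t].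
    exact: measurable_funX.
  by rewrite normrX lerXn2r ?nnegrE// (le_trans (normr_ge0 _) (fK t)).
have ab : \int[mu]_t a t ^+ 2 + \int[mu]_t b t ^+ 2 =
    - complex.Im (G theta w) / complex.Im w.
  rewrite -meanD; [|exact: h2|exact: h2].
  have -> : - complex.Im (G theta w) / complex.Im w =
      - (complex.Im w)^-1 * complex.Im (G theta w) by ring.
  rewrite /G /cmean/= -meanZ//; apply: eq_Rintegral => t _.
  by rewrite /a /b -cmod_sqr cmod_resolvent_sqr//; ring.
have ba := bessel_1t ma aK; have bb := bessel_1t mb bK.
pose c := cmean mu (fun t => t%:C * (w - (theta * t)%:C)^-1).
have cE : cmod c ^+ 2 = (\int[mu]_t (t * a t)) ^+ 2 + (\int[mu]_t (t * b t)) ^+ 2.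
  rewrite cmod_sqr /c/=; congr (_ ^+ 2 + _ ^+ 2); apply: eq_Rintegral => t _.
    by rewrite complexReM/= mul0r subr0.
  by rewrite complexImM/= mul0r addr0.
have GE : cmod (G theta w) ^+ 2 = (\int[mu]_t a t) ^+ 2 + (\int[mu]_t b t) ^+ 2.
  by rewrite cmod_sqr.
have wG : w * G theta w - 1 = theta%:C * c.
  rewrite /G /c -!cmeanZ//; last exact: has_cmean_tk.
  have -> : 1 = cmean mu (fun t => (1 : R)%:C) :> R[i] by rewrite cmeanC mean_cst.
  apply/eqP; rewrite subr_eq -cmeanD; last 2 first.
  - by apply: has_cmeanZ; exact: has_cmean_tk.
  - by apply: has_cmeanC; exact: has_mean_cst.
  apply/eqP; apply: eq_cmean => t.
  have := resolvent_neq0 (theta * t) w0.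
  by rewrite rmorphM/= => h; rewrite rmorph1; field.
split.
  rewrite -ab GE.
  have := sqr_ge0 (\int[mu]_t (t * a t)); have := sqr_ge0 (\int[mu]_t (t * b t)).
  lra.
rewrite wG cmodM exprMn cmodC real_normK ?num_real//.
by rewrite ler_wpM2l ?sqr_ge0// -ab GE cE; lra.
Qed.

(** With [F = 1 / G], division of the two Bessel bounds by [|G|^2] gives
    [Im F >= Im w] and [|w - F|^2 <= theta^2 (Im F / Im w - 1)]; since
    [Im F - Im w <= |w - F|], one factor [|w - F|] cancels in the latter. *)
Lemma reciprocal_cauchy_bounds (theta : R) (w : R[i]) : 0 < complex.Im w ->
  [/\ G theta w != 0, complex.Im w <= complex.Im (G theta w)^-1 &
      cmod (w - (G theta w)^-1) <= theta ^+ 2 / complex.Im w].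
Proof.
move=> w0; have [] := cmod_cauchy_bessel theta w0.
set g := G theta w; set y := complex.Im w => h1 h2.
have g0 : g != 0.
  apply/eqP => g0; move: h2; rewrite g0 mulr0 add0r /= oppr0 mul0r.
  have -> : cmod (-1 : R[i]) = 1 by rewrite cmodN (_ : 1 = 1%:C)// cmodC normr1.
  have -> : cmod (0 : R[i]) = 0 by apply/eqP; rewrite cmod_eq0.
  by rewrite expr0n/= subr0 mulr0 expr1n ler10.
have cg : 0 < cmod g by rewrite cmod_gt0.
have ImF : complex.Im g^-1 = - complex.Im g / cmod g ^+ 2 by rewrite complexImV.
have yF : y <= complex.Im g^-1.
  rewrite ImF ler_pdivlMr ?exprn_gt0// mulrC -ler_pdivlMr//.
split => //.
have wgE : w * g - 1 = g * (w - g^-1) by rewrite mulrBr mulfV// mulrC.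
set d := cmod (w - g^-1).
have d0 : 0 <= d := cmod_ge0 _.
have dF : complex.Im g^-1 - y <= d.
  rewrite /d -cmodN opprB (le_trans (ler_norm _))// (le_trans _ (ler_Im_cmod _))//.
  by rewrite complexImD complexImN.
have {h2} h2 : d ^+ 2 <= theta ^+ 2 * ((complex.Im g^-1 - y) / y).
  move: h2; rewrite wgE cmodM exprMn -/d ImF => h2.
  rewrite -(ler_pM2l (exprn_gt0 2 cg)) (le_trans h2)// le_eqVlt; apply/orP; left.
  by apply/eqP; field; rewrite !gt_eqF.
have {}h2 : d ^+ 2 <= theta ^+ 2 * (d / y).
  by rewrite (le_trans h2)// ler_wpM2l ?sqr_ge0// ler_pM2r ?invr_gt0.
have [->|dn0] := eqVneq d 0; first by rewrite divr_ge0 ?sqr_ge0// ltW.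
have dp : 0 < d by rewrite lt_neqAle eq_sym dn0.
rewrite -(ler_pM2l dp) -expr2 (le_trans h2)// le_eqVlt; apply/orP; left.
by apply/eqP; field; rewrite gt_eqF.
Qed.

End bessel.

(** * Fourth moment expansion *)

Lemma abs_moment_ge0 (R : realType) (mu : probability R R) k :
  0 <= abs_moment mu k.
Proof. by apply: Rintegral_ge0 => t _; rewrite exprn_ge0. Qed.

Section fourth_moment.
Context {R : realType} (mu : probability R R).
Hypothesis fourth_mean : has_mean mu (fun t : R => t ^+ 4).
Hypothesis mean0 : \int[mu]_t t = 0.
Hypothesis var1 : \int[mu]_t t ^+ 2 = 1.

Lemma norm_pow_le (t : R) (k : nat) : (k <= 4)%N -> `|t| ^+ k <= 1 + t ^+ 4.
Proof.
move=> k4; have t4 : t ^+ 4 = `|t| ^+ 4.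
  by rewrite -normrX ger0_norm// exprn_even_ge0.
have [t1|t1] := leP `|t| 1.
  by rewrite (@le_trans _ _ 1) ?exprn_ile1// lerDl t4 exprn_ge0.
by rewrite t4 (le_trans (ler_weXn2l (ltW t1) k4))// lerDr.
Qed.

Lemma has_mean_norm_pow (k : nat) : (k <= 4)%N ->
  has_mean mu (fun t : R => `|t| ^+ k).
Proof.
move=> k4; apply: (has_mean_dom (g := fun t : R => 1 + t ^+ 4)) => [|t|].
- by apply: measurable_funX; exact: normr_measurable.
- by rewrite ger0_norm ?exprn_ge0// norm_pow_le.
- exact: has_meanD (has_mean_cst _ _) _.
Qed.

Lemma has_mean_pow (k : nat) : (k <= 4)%N -> has_mean mu (fun t : R => t ^+ k).
Proof.
move=> k4; apply: has_mean_dom (has_mean_norm_pow k4) => [|t].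
  exact: measurable_funX.
by rewrite normrX.
Qed.

Let G (theta : R) (w : R[i]) := cmean mu (fun t => (w - (theta * t)%:C)^-1).

(** The geometric expansion of the resolvent to order four.  Its last term
    [theta^4 t^4 / (w^4 (w - theta t))] is kept exact, so that only the height of
    [w] and the fourth moment enter the error. *)
Lemma cauchy_expansion (theta : R) (w : R[i]) : 0 < complex.Im w ->
  cmod (G theta w - w^-1 - (theta ^+ 2)%:C / w ^+ 3) <=
  (`|theta| ^+ 3 * abs_moment mu 3 +
   2 * (theta ^+ 4 * abs_moment mu 4 / complex.Im w)) / cmod w ^+ 4.
Proof.
move=> w0; set y := complex.Im w.
have wn0 := upper_neq0 w0.
pose k t := (w - (theta * t)%:C)^-1.
pose p (t : R) := t%:C ^+ 4 * k t.
have p_le t : cmod (p t) <= y^-1 * `|t| ^+ 4.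
  rewrite /p cmodM cmodX cmodC mulrC ler_wpM2r ?exprn_ge0//.
  exact: cmod_resolvent_le.
have hdom : has_mean mu (fun t => y^-1 * `|t| ^+ 4).
  exact: has_meanZ (has_mean_norm_pow _).
have pE t : p t = (t ^+ 4)%:C * k t by rewrite rmorphXn.
have hp : has_cmean mu p.
  split; apply: (has_mean_dom _ _ hdom) => [|t].
  - under eq_fun do rewrite pE complexReM/= mul0r subr0.
    apply: measurable_funM; first exact: measurable_funX.
    exact: measurable_Re_resolvent.
  - exact: le_trans (ler_Re_cmod _) (p_le t).
  - under eq_fun do rewrite pE complexImM/= mul0r addr0.
    apply: measurable_funM; first exact: measurable_funX.
    exact: measurable_Im_resolvent.
  - exact: le_trans (ler_Im_cmod _) (p_le t).
have hX j : (j <= 4)%N -> has_cmean mu (fun t => (t ^+ j)%:C).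
  by move=> j4; apply: has_cmeanC; exact: has_mean_pow.
have -> : G theta w = w^-1 + ((theta ^+ 2)%:C / w ^+ 3 +
    ((theta ^+ 3)%:C / w ^+ 4 * (\int[mu]_t t ^+ 3)%:C +
     (theta ^+ 4)%:C / w ^+ 4 * cmean mu p)).
  transitivity (cmean mu (fun t => w^-1 * (t ^+ 0)%:C +
     (theta%:C / w ^+ 2 * (t ^+ 1)%:C +
     ((theta ^+ 2)%:C / w ^+ 3 * (t ^+ 2)%:C +
      ((theta ^+ 3)%:C / w ^+ 4 * (t ^+ 3)%:C +
       (theta ^+ 4)%:C / w ^+ 4 * p t))))).
    apply: eq_cmean => t; have := resolvent_neq0 (theta * t) w0.
    rewrite /p /k !rmorphXn !rmorphM/= => h.
    by field; rewrite h wn0.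
  have h4 := has_cmeanZ ((theta ^+ 4)%:C / w ^+ 4) hp.
  have h3 := has_cmeanZ ((theta ^+ 3)%:C / w ^+ 4) (hX 3%N isT).
  have h2 := has_cmeanZ ((theta ^+ 2)%:C / w ^+ 3) (hX 2%N isT).
  have h1 := has_cmeanZ (theta%:C / w ^+ 2) (hX 1%N isT).
  have h0 := has_cmeanZ w^-1 (hX 0%N isT).
  have h34 := has_cmeanD h3 h4.
  have h24 := has_cmeanD h2 h34.
  rewrite (cmeanD h0 (has_cmeanD h1 h24)) (cmeanD h1 h24) (cmeanD h2 h34).
  rewrite (cmeanD h3 h4) !cmeanZ//; try exact: hX.
  rewrite !cmeanC mean0 var1.
  under eq_Rintegral do rewrite expr0.
  by rewrite mean_cst !rmorph1 rmorph0 !mulr1 mulr0 add0r.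
set m3 := \int[mu]_t _.
have -> : forall a b c : R[i], a + (b + c) - a - b = c by move=> *; ring.
have -> : (theta ^+ 3)%:C / w ^+ 4 * m3%:C + (theta ^+ 4)%:C / w ^+ 4 * cmean mu p
   = ((theta ^+ 3 * m3)%:C + (theta ^+ 4)%:C * cmean mu p) / w ^+ 4.
  by rewrite rmorphM/=; ring.
rewrite cmodM cmodV cmodX ler_wpM2r ?invr_ge0 ?exprn_ge0 ?cmod_ge0//.
apply: le_trans (cmodD _ _) _; rewrite !cmodM !cmodC normrM !normrX; apply: lerD.
  rewrite ler_wpM2l ?exprn_ge0//; apply: norm_mean_le; last by move=> t; rewrite normrX.
    exact: has_mean_pow.
  exact: has_mean_norm_pow.
have -> : `|theta| ^+ 4 = theta ^+ 4 by rewrite -normrX ger0_norm// exprn_even_ge0.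
rewrite -mulrA mulrCA ler_wpM2l ?exprn_even_ge0//.
rewrite (le_trans (cmod_cmean_le hp hdom p_le))//.
by rewrite meanZ ?has_mean_norm_pow// [y^-1 * _]mulrC.
Qed.

(** For [w = Z_i z] the quantity [w - F] is the contribution of one summand to
    [z - F], and here [F = 1 / G].  Its main term is [theta^2 / w]; replacing [w]
    by [F] costs [theta^2 |w - F| / |w F|].  The smallness of [theta^2 / v] keeps
    [|w|] comparable with [|F|], which may be as small as [1 / 4]. *)
Lemma summand_remainder (theta v : R) (w : R[i]) : 0 < v -> v <= complex.Im w ->
  theta ^+ 2 <= v / 8 -> 4^-1 <= cmod (G theta w)^-1 ->
  cmod (w - (G theta w)^-1 - (theta ^+ 2)%:C * G theta w) <=
  (96 + 256 * abs_moment mu 4) * (theta ^+ 4 / v) +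
  128 * abs_moment mu 3 * `|theta| ^+ 3.
Proof.
move=> v0 vw thv.
have w0 : 0 < complex.Im w := lt_le_trans v0 vw.
have wn0 := upper_neq0 w0.
have [] := reciprocal_cauchy_bounds (has_mean_pow (isT : (2 <= 4)%N)) mean0 var1 theta w0.
rewrite -/(G theta w) => g0 _.
have := cauchy_expansion theta w0; rewrite -/(G theta w).
move: (G theta w) g0 => g g0.
set E := g - _ - _ => /[swap] hH hE F4.
have {}hH : cmod (w - g^-1) <= theta ^+ 2 / v.
  by rewrite (le_trans hH)// ler_wpM2l ?sqr_ge0// lef_pV2.
have b3 := abs_moment_ge0 mu 3; have b4 := abs_moment_ge0 mu 4.
have H8 : cmod (w - g^-1) <= 8^-1.
  by rewrite (le_trans hH)// ler_pdivrMr// mulrC.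
have w8 : 8^-1 <= cmod w.
  have := cmodB w (w - g^-1); rewrite opprB addrCA subrr addr0; lra.
have F2 : cmod g^-1 <= 2 * cmod w.
  have := cmodB w (w - g^-1); rewrite opprB addrCA subrr addr0; lra.
have cw0 : 0 < cmod w by rewrite (lt_le_trans _ w8).
have u64 : 64^-1 <= cmod w ^+ 2 by nra.
(* The first two terms expand [w - F] around [theta^2 / w]; the third replaces
   [1 / w] by [1 / F]. *)
have -> : w - g^-1 - (theta ^+ 2)%:C * g =
   - ((theta ^+ 2)%:C * (w - g^-1) / w ^+ 2) + w * E * g^-1
    - (theta ^+ 2)%:C * (w - g^-1) / (w * g^-1).
  by rewrite /E; field; rewrite g0 wn0.
(* [|F| <= 2 |w|] and [E = O(|w|^(-4))], so this term is [O(|w|^(-2))]. *)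
have hE' : cmod (w * E * g^-1) <=
    128 * (`|theta| ^+ 3 * abs_moment mu 3 + 2 * (theta ^+ 4 * abs_moment mu 4 / v)).
  set B := _ + _ in hE; set B' := (X in _ <= _ * X).
  have BB' : B <= B'.
    rewrite lerD2l ler_wpM2l// ler_wpM2l ?lef_pV2//.
    by rewrite mulr_ge0 ?exprn_even_ge0.
  have B'0 : 0 <= B'.
    have t4 : 0 <= theta ^+ 4 by rewrite exprn_even_ge0.
    have vi : 0 <= v^-1 by rewrite invr_ge0 ltW.
    have p3 : 0 <= `|theta| ^+ 3 by rewrite exprn_ge0.
    exact: addr_ge0 (mulr_ge0 p3 b3) (mulr_ge0 (ler0n _ _) (mulr_ge0 (mulr_ge0 t4 b4) vi)).
  rewrite !cmodM; apply: (@le_trans _ _ (cmod w * (B' / cmod w ^+ 4) * (2 * cmod w))).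
    apply: ler_pM => //; rewrite ?mulr_ge0 ?cmod_ge0//.
    rewrite ler_wpM2l ?cmod_ge0// (le_trans hE)// ler_wpM2r//.
    by rewrite invr_ge0 exprn_ge0// cmod_ge0.
  have -> : cmod w * (B' / cmod w ^+ 4) * (2 * cmod w) = 2 * B' / cmod w ^+ 2.
    by field; rewrite gt_eqF.
  rewrite ler_pdivrMr ?exprn_gt0//.
  by have := ler_wpM2l B'0 u64; rewrite mulrA; lra.
have hu : (cmod w ^+ 2)^-1 <= 64.
  by rewrite -[64]invrK lef_pV2 ?posrE ?exprn_gt0.
have huf : (cmod w * cmod g^-1)^-1 <= 32.
  rewrite -[32]invrK lef_pV2 ?posrE ?mulr_gt0//; first nra.
  by rewrite (lt_le_trans _ F4).
have h1 c (K : R) : 0 <= c -> c <= K ->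
    cmod ((theta ^+ 2)%:C * (w - g^-1)) * c <= K * (theta ^+ 4 / v).
  move=> c0 cK; rewrite mulrC; apply: ler_pM; rewrite ?cmod_ge0//.
  rewrite cmodM cmodC ger0_norm ?sqr_ge0//.
  by rewrite (le_trans (ler_wpM2l (sqr_ge0 _) hH))// mulrA -exprD.
have hu0 : 0 <= (cmod w ^+ 2)^-1 by rewrite invr_ge0 exprn_ge0 ?cmod_ge0.
have huf0 : 0 <= (cmod w * cmod g^-1)^-1 by rewrite invr_ge0 mulr_ge0 ?cmod_ge0.
have t1 := h1 _ _ hu0 hu; have t3 := h1 _ _ huf0 huf.
apply: le_trans (cmodB _ _) _.
apply: le_trans (lerD (cmodD _ _) (lexx _)) _.
rewrite cmodN (cmodM _ (w ^+ 2)^-1) (cmodM _ (w * g^-1)^-1) !cmodV cmodX (cmodM w g^-1).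
rewrite cmodV in t1 t3 *.
move: t1 t3 hE'; lra.
Qed.

End fourth_moment.

(** * The self-consistent equation *)

Section self_consistency.
Context {R : realType} (mu : probability R R).
Hypothesis fourth_mean : has_mean mu (fun t : R => t ^+ 4).
Hypothesis mean0 : \int[mu]_t t = 0.
Hypothesis var1 : \int[mu]_t t ^+ 2 = 1.
Context (n : nat) (theta : 'I_n -> R) (Z : 'I_n -> R[i]) (z F : R[i]).
Hypothesis Im_Z : forall i, 0 < complex.Im (Z i).
Hypothesis sum_Z : (0 < n)%N -> \sum_(j < n) Z j - z = (n%:R - 1) * F.
Hypothesis FE : forall i,
  F = reciprocal_cauchy_transform (dilation (theta i) mu) (Z i).

Let square_mean := has_mean_pow fourth_mean (isT : (2 <= 4)%N).

Let F_cmean i : F = (cmean mu (fun t => (Z i - (theta i * t)%:C)^-1))^-1.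
Proof. by rewrite (FE i) /reciprocal_cauchy_transform cauchy_transform_dilation. Qed.

Let sum_ZF : (0 < n)%N -> \sum_(j < n) (Z j - F) = z - F.
Proof.
move=> /sum_Z; rewrite sumrB sumr_const card_ord -mulr_natl => /eqP.
by rewrite subr_eq => /eqP ->; ring.
Qed.

(** Each summand has [Im F >= Im Z_j], so the single deficit [Im F - Im Z_i] is
    at most the total one, which is [Im F - Im z]. *)
Lemma Im_subordination_ge i : complex.Im z <= complex.Im (Z i).
Proof.
have ImF j : complex.Im (Z j) <= complex.Im F.
  rewrite (F_cmean j).
  by have [] := reciprocal_cauchy_bounds square_mean mean0 var1 (theta j) (Im_Z j).
have n0 : (0 < n)%N by case: (n) i => // -[].
have := congr1 (fun x => complex.Im x) (sum_ZF n0).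
rewrite Im_sum (bigD1 i)//= !complexImD complexImN.
suff : \sum_(j < n | j != i) complex.Im (Z j - F) <= 0 by lra.
by apply: sumr_le0 => j _; rewrite complexImD complexImN subr_le0.
Qed.

(** Summation of [summand_remainder]: the main terms add up to [1 / F] because
    [\sum_i theta_i^2 = 1]. *)
Lemma self_consistent_equation (v : R) : (0 < n)%N ->
  0 < v -> v <= complex.Im z ->
  \sum_(i < n) theta i ^+ 2 = 1 -> (forall i, theta i ^+ 2 <= v / 8) ->
  4^-1 <= cmod F ->
  cmod (z - (F + F^-1)) <=
  (96 + 256 * abs_moment mu 4) * ((\sum_(i < n) theta i ^+ 4) / v) +
  128 * abs_moment mu 3 * \sum_(i < n) `|theta i| ^+ 3.
Proof.
move=> n0 v0 vz theta1 theta_small F4.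
have -> : z - (F + F^-1) = \sum_(i < n) (Z i - F - (theta i ^+ 2)%:C * F^-1).
  by rewrite sumrB sum_ZF// -mulr_suml -rmorph_sum/= theta1; ring.
apply: le_trans (cmod_sum _) _.
rewrite mulr_suml !mulr_sumr -big_split/=; apply: ler_sum => i _.
move: F4; rewrite (F_cmean i) invrK => F4.
apply: summand_remainder => //.
exact: le_trans vz (Im_subordination_ge i).
Qed.

End self_consistency.

Section bootstrap.
Context {R : realType} (nu : probability R R).

Lemma cauchy_transform_lipschitz (z w : R[i]) :
  0 < complex.Im z -> 0 < complex.Im w ->
  cmod (cauchy_transform nu z - cauchy_transform nu w) <=
  2 * (cmod (z - w) / (complex.Im z * complex.Im w)).
Proof.
move=> z0 w0.
have hz := has_cmean_resolvent1 nu z0; have hw := has_cmean_resolvent1 nu w0.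
have -> : cauchy_transform nu z - cauchy_transform nu w =
    cmean nu (fun t => (z - t%:C)^-1 + -1 * (w - t%:C)^-1).
  by rewrite cmeanD ?cmeanZ ?mulN1r//; exact: has_cmeanZ.
rewrite -[X in _ <= _ * X](mean_cst nu).
apply: cmod_cmean_le => [||t]; last 1 first.
- have zt := resolvent_neq0 t z0; have wt := resolvent_neq0 t w0.
  have -> : (z - t%:C)^-1 + -1 * (w - t%:C)^-1 =
     - ((z - w) * ((z - t%:C)^-1 * (w - t%:C)^-1)).
    by field; rewrite zt wt.
  rewrite cmodN cmodM ler_wpM2l ?cmod_ge0// cmodM invfM.
  by apply: ler_pM; rewrite ?cmod_ge0 ?cmod_resolvent_le.
- by apply: has_cmeanD => //; exact: has_cmeanZ.
- exact: has_mean_cst.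
Qed.

Lemma cmod_cauchy_le (z : R[i]) : 0 < complex.Im z ->
  cmod (cauchy_transform nu z) <= 2 / complex.Im z.
Proof.
move=> z0; rewrite -[X in _ <= _ * X](mean_cst nu).
apply: cmod_cmean_le => [||t]; [exact: has_cmean_resolvent1|exact: has_mean_cst|].
exact: cmod_resolvent_le.
Qed.

Lemma continuous_cmod_cauchy (u v : R) : 0 < v ->
  {for v, continuous (fun v => cmod (cauchy_transform nu (u +i* v)))}.
Proof.
move=> v0; apply/cvgrPdist_le => e e0; near=> v'.
have v'2 : v / 2 < v' by near: v'; apply: lt_nbhsr; lra.
have vv' : `|v - v'| <= e * v ^+ 2 / 4.
  near: v'; apply: cvgr_dist_le; first exact: cvg_id.
  by rewrite divr_gt0// mulr_gt0 ?exprn_gt0.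
have v'0 : 0 < v' by lra.
rewrite (le_trans (ler_dist_cmod _ _))//.
have := @cauchy_transform_lipschitz (u +i* v) (u +i* v') v0 v'0.
move=> /le_trans; apply => /=.
have -> : cmod (u +i* v - (u +i* v')) = `|v - v'|.
  by rewrite /cmod complexReD complexImD complexReN complexImN/= subrr expr0n/= add0r sqrtr_sqr.
rewrite mulrA ler_pdivrMr ?mulr_gt0//.
have : e * v * (v / 2) <= e * v * v' by rewrite ler_wpM2l ?ltW// mulr_gt0.
by nra.
Unshelve. all: by end_near. Qed.

(** If the self-consistent equation holds with error less than [3/4] wherever
    [|F| >= 1/4], then [|F| = 1/4] is impossible below height [1] over
    [-2, 2], because there [|F + 1/F| >= 15/4 >= |z| + 3/4].  Since [|F| > 1/4] at
    height [1], it stays so on the way down. *)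
Lemma cmod_cauchy_le4 (v0 u : R) : 0 < v0 -> `|u| <= 2 ->
  (forall v, v0 <= v <= 1 ->
     let F := reciprocal_cauchy_transform nu (u +i* v) in
     4^-1 <= cmod F -> cmod (u +i* v - (F + F^-1)) < 3 / 4) ->
  forall v, v0 <= v <= 1 -> cmod (cauchy_transform nu (u +i* v)) <= 4.
Proof.
move=> v00 u2 equation v /andP[v0v v1]; rewrite leNgt; apply/negP => G4.
pose g v := cmod (cauchy_transform nu (u +i* v)).
have vpos : 0 < v by exact: lt_le_trans v0v.
have cg : {within `[v, 1], continuous g}.
  apply: continuous_in_subspaceT => x; rewrite inE/= in_itv/= => /andP[vx _].
  by apply: continuous_cmod_cauchy; exact: lt_le_trans vx.
have g1 : g 1 <= 2.
  by have := @cmod_cauchy_le (u +i* 1); rewrite /= divr1; apply.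
have [|c] := IVT v1 cg (v := 4).
  rewrite ge_min le_max; apply/andP; split; apply/orP; [right|left].
    by rewrite (le_trans g1)// ler_nat.
  exact: ltW.
rewrite in_itv/= => /andP[vc c1] gc.
have c0 : 0 < c := lt_le_trans vpos vc.
have := equation c; rewrite (le_trans v0v vc) c1 => /(_ isT)/=.
set F := reciprocal_cauchy_transform _ _.
have F4 : cmod F = 4^-1 by rewrite /F cmodV -/(g c) gc.
rewrite F4 => /(_ (lexx _)).
have Fi : cmod F^-1 = 4 by rewrite cmodV F4 invrK.
have z3 : cmod (u +i* c) <= 3.
  by apply: le_trans (cmod_le_ReIm _) _ => /=; rewrite (gtr0_norm c0); lra.
have := cmodB (u +i* c - F) (u +i* c - (F + F^-1)).
have -> : u +i* c - F - (u +i* c - (F + F^-1)) = F^-1 by ring.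
have := cmodB (u +i* c) F; lra.
Qed.

End bootstrap.

(** * Cauchy distribution functions *)

Section arctan_kernel.
Context {R : realType}.
Implicit Types (x s v : R).

Let pi0 : (0 : R) < pi. Proof. exact: pi_gt0. Qed.

Lemma le_derive_ge0 (f df : R -> R) (a b : R) : a <= b ->
  (forall x, x \in `[a, b] -> is_derive x (1 : R) f (df x)) ->
  (forall x, x \in `[a, b] -> 0 <= df x) -> f a <= f b.
Proof.
move=> ab fdf df0.
have d_oo x : x \in `]a, b[ -> is_derive x (1 : R) f (df x).
  by rewrite in_itv/= => /andP[ax xb]; apply: fdf; rewrite in_itv/= !ltW.
have cf : {within `[a, b], continuous f}.
  by apply: derivable_within_continuous => x /fdf [].
have [c cab] := MVT_segment ab d_oo cf.
by move=> /eqP; rewrite subr_eq => /eqP ->; rewrite lerDr mulr_ge0 ?df0// subr_ge0.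
Qed.

Definition cauchy_cdf (x : R) : R := 2^-1 + atan x / pi.

Lemma cauchy_cdfN x : cauchy_cdf (- x) = 1 - cauchy_cdf x.
Proof. by rewrite /cauchy_cdf atanN; lra. Qed.

(** As [pi - 2 atan x] tends to zero at infinity, a monotone function can be
    compared with its limit zero through a crude bound near infinity. *)
Lemma le_atan_gap (c a : R) :
  (forall x, a <= x -> c <= pi - 2 * atan x) -> c <= 0.
Proof.
move=> ca; have : (pi - 2 * atan x) @[x --> +oo] --> (pi - 2 * (pi / 2) : R).
  by apply: cvgB; [exact: cvg_cst|apply: cvgM; [exact: cvg_cst|exact: cvgy_atan]].
rewrite mulrCA mulfV ?pnatr_eq0// mulr1 subrr.
move=> /cvgr_to_ge; apply; near=> x; apply: ca.
by near: x; apply: nbhs_pinfty_ge; exact: num_real.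
Unshelve. all: by end_near. Qed.

(** For [x >= 0], [h x / pi] is the error of [2 A(x) - A(x / 2)] against [1], with
    [A] the Cauchy distribution function.  It increases to zero, at a rate that
    makes [h x + 3 / (1 + x)^2] decrease to zero. *)
Let h (x : R) : R := 2 * atan x - atan (x / 2) - pi / 2.

Let dh x : is_derive x (1 : R) h (6 / ((1 + x ^+ 2) * (4 + x ^+ 2))).
Proof.
rewrite /h; apply: is_derive_eq.
rewrite /GRing.scale/=; field.
by have := sqr_ge0 x => x2; rewrite !gt_eqF//; lra.
Qed.

Let h_le0 x : h x <= 0.
Proof.
apply: (@le_atan_gap _ (x / 2)) => y x2y.
apply: (@le_trans _ _ (h (2 * y))).
  apply: (@le_derive_ge0 _ (fun x => 6 / ((1 + x ^+ 2) * (4 + x ^+ 2)))) => [|z _|z _].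
  - lra.
  - exact: dh.
  - by rewrite divr_ge0// mulr_ge0// addr_ge0// sqr_ge0.
rewrite /h mulrAC mulfV// mul1r.
have := ltW (atan_ltpi2 (2 * y)); have := ltW (atan_ltpi2 y).
by move: pi (atan _) (atan _) => p a b; lra.
Qed.

Let h_ge x : 0 <= x -> - 3 / (1 + x ^+ 2) <= h x.
Proof.
move=> x0; suff hx : - h x - 3 / (1 + x) ^+ 2 <= 0.
  have : 3 / (1 + x) ^+ 2 <= 3 / (1 + x ^+ 2).
    rewrite ler_pM2l// lef_pV2 ?posrE ?exprn_gt0 ?ltr_pwDl ?sqr_ge0//.
    by rewrite sqrrD; nra.
  by move: hx; move: (h x) => a; lra.
apply: (@le_atan_gap _ x) => y xy.
apply: (@le_trans _ _ (- h y - 3 / (1 + y) ^+ 2)).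
  pose f (z : R) : R := - h z - 3 * ((1 + z) ^+ 2)^-1.
  pose df (z : R) : R := - (6 / ((1 + z ^+ 2) * (4 + z ^+ 2))) + 6 / (1 + z) ^+ 3.
  have d1 z : z \in `[x, y] -> is_derive z (1 : R) f (df z).
    rewrite in_itv/= => /andP[xz _]; have z0 : 0 <= z := le_trans x0 xz.
    have dhz := dh z.
    have z1 : (1 + z) ^+ 2 != 0 by rewrite expf_neq0// gt_eqF//; lra.
    rewrite /f; apply: is_derive_eq.
    rewrite /df /GRing.scale/=; field.
    by rewrite !gt_eqF//; have := sqr_ge0 z; lra.
  have d2 z : z \in `[x, y] -> 0 <= df z.
    rewrite in_itv/= => /andP[xz _]; have z0 : 0 <= z := le_trans x0 xz.
    rewrite /df addrC subr_ge0 ler_pM2l// lef_pV2 ?posrE; last 2 first.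
    - by rewrite mulr_gt0// ltr_pwDl// sqr_ge0.
    - by rewrite exprn_gt0//; lra.
    have z1 : 1 + z <= (4 + z ^+ 2) / 2.
      by have := sqr_ge0 (z - 1); rewrite sqrrB; lra.
    have z2 : (1 + z) ^+ 2 <= 2 * (1 + z ^+ 2).
      by have := sqr_ge0 (z - 1); rewrite sqrrB sqrrD; lra.
    have := ler_pM (addr_ge0 ler01 z0) (sqr_ge0 (1 + z)) z1 z2.
    rewrite -exprS => /le_trans; apply.
    by rewrite le_eqVlt; apply/orP; left; apply/eqP; field.
  exact: (le_derive_ge0 xy d1 d2).
rewrite /h.
have : 0 <= 3 / (1 + y) ^+ 2 by rewrite divr_ge0// sqr_ge0.
have := ltW (atan_ltpi2 (y / 2)).
by move: pi (atan _) (atan _) (3 / _) => p a b c; lra.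
Qed.

(** The combination [2 A_v - A_{2v}] of Cauchy distribution functions cancels the
    leading [1 / s] tail of each.  What is left is dominated by the Poisson kernel
    itself, so that the smoothing error is controlled by the smoothed density. *)
Lemma cauchy_cdf_combination_gap s v : 0 < v ->
  `|2 * cauchy_cdf (s / v) - cauchy_cdf (s / (2 * v)) - (0 <= s)%R%:R| <=
  3 / 2 * (v ^+ 2 / (s ^+ 2 + v ^+ 2)).
Proof.
have key x : 0 <= x -> `|2 * cauchy_cdf x - cauchy_cdf (x / 2) - 1| <=
    3 / 2 * (1 + x ^+ 2)^-1.
  move=> x0.
  have -> : 2 * cauchy_cdf x - cauchy_cdf (x / 2) - 1 = h x / pi.
    rewrite /cauchy_cdf /h; move: pi pi0 (atan x) (atan (x / 2)) => p p0 a b.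
    by field; rewrite gt_eqF.
  rewrite normrM (ler0_norm (h_le0 x)) gtr0_norm ?invr_gt0//.
  rewrite mulrAC ler_pM ?oppr_ge0 ?invr_ge0 ?(ltW pi0)//.
    by rewrite lerNl -mulNr h_ge.
  by rewrite lef_pV2 ?posrE// pi_ge2.
move=> v0; have v2E (a : R) : a / (2 * v) = a / v / 2 by rewrite invfM mulrA mulrAC.
have E : v ^+ 2 / (s ^+ 2 + v ^+ 2) = (1 + (s / v) ^+ 2)^-1.
  have : 0 < s ^+ 2 + v ^+ 2 by rewrite ltr_wpDl ?sqr_ge0 ?exprn_gt0.
  by move=> sv; field; rewrite !gt_eqF// addrC.
rewrite v2E E; have [s0|s0] := leP 0 s.
  by apply: key; rewrite divr_ge0// ltW.
have /key : 0 <= - s / v by rewrite divr_ge0 ?oppr_ge0 ?(ltW s0) ?(ltW v0).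
rewrite !mulNr sqrrN !cauchy_cdfN mulr0n subr0.
set a := cauchy_cdf _; set b := cauchy_cdf _ => le_ab.
have -> : 2 * a - b = - (2 * (1 - a) - (1 - b) - 1) by ring.
by rewrite normrN.
Qed.

Lemma cauchy_cdf_itv x : 0 <= cauchy_cdf x <= 1.
Proof.
rewrite /cauchy_cdf; have := ltW (atan_ltpi2 x); have := ltW (atan_gtNpi2 x).
move: pi pi0 (atan x) => p p0 a h1 h2.
have -> : 2^-1 + a / p = (p / 2 + a) / p by field; rewrite gt_eqF.
by rewrite divr_ge0 ?ler_pdivrMr ?(ltW p0)//=; lra.
Qed.

Lemma measurable_cauchy_cdf : measurable_fun setT cauchy_cdf.
Proof.
apply: continuous_measurable_fun => x; apply: cvgD; first exact: cvg_cst.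
by apply: cvgM; [exact: continuous_atan|exact: cvg_cst].
Qed.

End arctan_kernel.

(** * Smoothed distribution functions *)

Section smoothing.
Context {R : realType} (nu : probability R R).
Implicit Types (x s t v : R).

Let pi0 : (0 : R) < pi. Proof. exact: pi_gt0. Qed.

(** Distribution function of the convolution of [nu] with the Cauchy law of
    scale [v]. *)
Definition smoothed_cdf v x : R := \int[nu]_t cauchy_cdf ((x - t) / v).

Let measurable_ccdf v x : measurable_fun setT (fun t : R => cauchy_cdf ((x - t) / v)).
Proof.
apply: (measurableT_comp measurable_cauchy_cdf).
apply: measurable_funM; last exact: measurable_cst.
exact: measurable_funB.
Qed.

Lemma has_mean_cauchy_cdf v x : has_mean nu (fun t => cauchy_cdf ((x - t) / v)).
Proof.
apply: (@has_mean_bounded _ _ _ _ 1) => // t.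
by have /andP[c0 c1] := cauchy_cdf_itv ((x - t) / v); rewrite ger0_norm.
Qed.

Lemma Im_resolventE x v t : 0 < v ->
  complex.Im (x +i* v - t%:C)^-1 = - (v / ((x - t) ^+ 2 + v ^+ 2)).
Proof. by move=> v0; rewrite Im_resolvent/= mulNr. Qed.

(** Stieltjes inversion at positive height: the density of the smoothed law is
    [- Im G / pi]. *)
Lemma is_derive_smoothed_cdf v x : 0 < v ->
  is_derive x (1 : R) (smoothed_cdf v)
    (- complex.Im (cauchy_transform nu (x +i* v)) / pi).
Proof.
move=> v0.
pose f x t := cauchy_cdf ((x - t) / v).
have df y t : is_derive y (1 : R) (f ^~ t) (v / ((y - t) ^+ 2 + v ^+ 2) / pi).
  rewrite /f /cauchy_cdf; apply: is_derive_eq.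
  have yt : 0 < (y - t) ^+ 2 + v ^+ 2 by rewrite ltr_wpDl ?sqr_ge0 ?exprn_gt0.
  rewrite /GRing.scale/=; move: pi pi0 => p p0; field.
  by rewrite !gt_eqF// addrC.
have d1E y t : partial1of2 f y t = v / ((y - t) ^+ 2 + v ^+ 2) / pi.
  by rewrite partial1of2E; have := df y t => ?; exact: derive_val.
have Ix : `](x - 1)%R, (x + 1)%R[%classic x by rewrite /= in_itv/=; apply/andP; split; lra.
have intf y : `](x - 1)%R, (x + 1)%R[%classic y -> nu.-integrable setT (EFin \o f y).
  by move=> _; exact: has_mean_cauchy_cdf.
have derf1 y t : `](x - 1)%R, (x + 1)%R[%classic y -> [set: R] t -> derivable (f ^~ t) y 1.
  by move=> _ _; have [] := df y t.
have G0 (t : R) : 0 <= v^-1 / pi by rewrite divr_ge0 ?invr_ge0 ?ltW.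
have intG : nu.-integrable setT (EFin \o (fun _ : R => v^-1 / pi)).
  exact: has_mean_cst.
have Gub y t : `](x - 1)%R, (x + 1)%R[%classic y -> [set: R] t ->
    `|partial1of2 f y t| <= v^-1 / pi.
  move=> _ _; have yt : 0 < (y - t) ^+ 2 + v ^+ 2 by rewrite ltr_wpDl ?sqr_ge0 ?exprn_gt0.
  rewrite d1E ger0_norm; last by rewrite !divr_ge0// ltW.
  rewrite ler_pM2r ?invr_gt0// ler_pdivrMr// mulrC ler_pdivlMr//.
  by rewrite expr2 lerDr sqr_ge0.
apply: DeriveDef.
  exact: (derivable_under_integral measurableT Ix intf derf1 G0 intG Gub).
rewrite -derive1E (differentiation_under_integral measurableT Ix intf derf1 G0 intG Gub).
have -> : - complex.Im (cauchy_transform nu (x +i* v)) / pi =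
    - pi^-1 * complex.Im (cauchy_transform nu (x +i* v)) by rewrite mulNr mulrC mulNr.
have [_ hIm] := @has_cmean_resolvent1 _ nu (x +i* v) v0.
rewrite -meanZ//; apply: eq_Rintegral => t _.
by rewrite d1E Im_resolventE// mulrNN mulrC.
Qed.

Definition cdf x : R := fine (nu `]-oo, x]%classic).

(** Integration of [cauchy_cdf_combination_gap]; the dominating Poisson kernel
    integrates to [- v Im G], so a bound on [G] at the single height [v] suffices. *)
Lemma smoothed_cdf_gap v x : 0 < v ->
  `|2 * smoothed_cdf v x - smoothed_cdf (2 * v) x - cdf x| <=
  3 / 2 * (v * - complex.Im (cauchy_transform nu (x +i* v))).
Proof.
move=> v0.
have h1 := has_mean_cauchy_cdf v x; have h2 := has_mean_cauchy_cdf (2 * v) x.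
have h3 := has_meanZ 2 h1; have h4 := has_meanB h3 h2.
have mI : measurable_fun setT (fun t : R => (0 <= x - t)%R%:R : R).
  rewrite (_ : (fun t => _) = \1_(`]-oo, x]%classic)); first exact: measurable_indic.
  by apply/funext => t; rewrite indicE mem_setE in_itv/= subr_ge0.
have h5 : has_mean nu (fun t : R => (0 <= x - t)%R%:R).
  apply: (@has_mean_bounded _ _ _ _ 1) => // t.
  by case: (0 <= x - t); rewrite ?normr1 ?normr0.
have -> : cdf x = \int[nu]_t (0 <= x - t)%R%:R.
  rewrite /cdf /Rintegral; congr fine.
  rewrite -[X in nu X]setIT -integral_indic//.
  by apply: eq_integral => t _; rewrite indicE mem_setE in_itv/= subr_ge0.
rewrite /smoothed_cdf -meanZ// -!meanB//.
have [_ hIm] := @has_cmean_resolvent1 _ nu (x +i* v) v0.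
have -> : 3 / 2 * (v * - complex.Im (cauchy_transform nu (x +i* v))) =
    (- (3 / 2 * v)) * complex.Im (cauchy_transform nu (x +i* v)) by ring.
rewrite -meanZ//; apply: norm_mean_le.
- exact: has_meanB.
- exact: has_meanZ.
- move=> t; rewrite Im_resolventE//.
  apply: le_trans (cauchy_cdf_combination_gap (x - t) v0) _.
  by rewrite le_eqVlt; apply/orP; left; apply/eqP; ring.
Qed.

End smoothing.

(** * The semicircle law and stability of its equation *)

Section semicircle_cdf.
Context {R : realType}.
Implicit Types x y : R.

Definition semicircle_cdf x : R := cdf (@semicircle R) x.

Lemma semicircle_cdfE x : semicircle_cdf x =
  \int[lebesgue_measure]_(y in `]-oo, x]) semicircle_pdf y.
Proof. by []. Qed.

Lemma is_derive_semicircle_cdf x :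
  is_derive x (1 : R) semicircle_cdf (semicircle_pdf x).
Proof.
have xx1 : x < x + 1 by rewrite ltrDl.
have int_pdf : lebesgue_measure.-integrable [set` Interval -oo%O (BRight (x + 1))]
    (EFin \o @semicircle_pdf R).
  by apply: integrableS integrable_semicircle_pdf.
have [d1 d2] := continuous_FTC1 xx1 int_pdf (ltNyr _) (@continuous_semicircle_pdf R x).
by apply: DeriveDef; [exact: d1|rewrite -derive1E; exact: d2].
Qed.

Lemma semicircle_pdf_out x : 2 <= `|x| -> semicircle_pdf x = 0.
Proof.
move=> x2; rewrite /semicircle_pdf ler0_sqrtr ?mul0r//.
by rewrite -(real_normK (num_real x)); have := normr_ge0 x; nra.
Qed.

Lemma semicircle_cdf_left x : x <= - 2 -> semicircle_cdf x = 0.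
Proof.
move=> x2; rewrite semicircle_cdfE; rewrite /Rintegral integral0_eq// => y /=.
rewrite in_itv/= => yx; rewrite semicircle_pdf_out//.
by rewrite ler0_norm; lra.
Qed.

Lemma semicircle_cdf_right x : 2 <= x -> semicircle_cdf x = 1.
Proof.
move=> x2; have : (semicircle (~` `]-oo, x]%classic) = 0 :> \bar R)%E.
  rewrite /semicircle integral0_eq// => y /=.
  rewrite in_itv/= => /negP; rewrite -ltNge => xy; rewrite semicircle_pdf_out//.
  by rewrite gtr0_norm; lra.
rewrite probability_setC// => h.
rewrite /semicircle_cdf /cdf.
have Wfin : semicircle `]-oo, x]%classic \is a fin_num by exact: fin_num_measure.
by have := congr1 fine h; rewrite fineB//=; lra.
Qed.

End semicircle_cdf.

Section stability.
Context {R : realType}.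

(** The semicircle density at [2 sin t] is [cos t / pi], the imaginary part of
    [- s / pi] for the root [s = sin t - i cos t] of [s + 1 / s = 2 sin t].  The
    identity [(G - s) (1 - F / s) = (G + F) - (s + 1 / s)] together with
    [|s - F| >= Im F + cos t] makes the quadratic equation stable without any
    restriction on the size of the perturbation. *)
Lemma semicircle_stability (t v : R) (F : R[i]) : 0 < v -> 0 <= cos t ->
  0 < complex.Im F ->
  `| - complex.Im F^-1 / pi - semicircle_pdf (2 * sin t)| * cos t <=
  (v + cmod ((2 * sin t) +i* v - (F + F^-1))) / pi.
Proof.
move=> v0 c0 F0; have Fn0 := upper_neq0 F0.
have pi0 := pi_gt0 R.
set e := _ - (F + F^-1).
have cs : cos t ^+ 2 + sin t ^+ 2 = 1 := cos2Dsin2 t.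
pose s : R[i] := sin t -i* cos t; pose s' : R[i] := sin t +i* cos t.
have ss' : s * s' = 1.
  by apply: complex_eqP; rewrite ?complexReM ?complexImM/=; lra.
have cmod_s : cmod s = 1.
  by rewrite /cmod/= sqrrN addrC cs sqrtr1.
have pdfE : semicircle_pdf (2 * sin t) = cos t / pi.
  rewrite /semicircle_pdf.
  have -> : 4 - (2 * sin t) ^+ 2 = (2 * cos t) ^+ 2 by rewrite !exprMn; lra.
  rewrite sqrtr_sqr ger0_norm ?mulr_ge0//.
  by move: pi pi0 => p p0; field; rewrite gt_eqF.
have prodE : (F^-1 - s) * (s - F) = s * (v *i - e).
  have -> : v *i - e = F + F^-1 - (s + s').
    rewrite /e opprB addrCA; congr (_ + _).
    by apply: complex_eqP; rewrite ?complexReD ?complexImD ?complexReN ?complexImN/=; lra.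
  have s0 : s != 0 by rewrite -cmod_gt0 cmod_s.
  by rewrite -[s'](mulKf s0) ss'; field; rewrite s0 Fn0.
have hprod : cmod (F^-1 - s) * cmod (s - F) <= v + cmod e.
  rewrite -cmodM prodE cmodM cmod_s mul1r (le_trans (cmodB _ _))// lerD2r.
  by rewrite /cmod/= expr0n/= add0r sqrtr_sqr gtr0_norm.
have h1 : `|complex.Im F^-1 + cos t| <= cmod (F^-1 - s).
  apply: le_trans (ler_Im_cmod _).
  by rewrite complexImD complexImN/= opprK.
have h2 : cos t <= cmod (s - F).
  rewrite -cmodN opprB; apply: le_trans (ler_Im_cmod _).
  by apply: le_trans (ler_norm _); rewrite complexImD complexImN/= opprK lerDr ltW.
rewrite pdfE -mulrBl normrM (gtr0_norm (_ : 0 < pi^-1)) ?invr_gt0//.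
rewrite mulrAC ler_pM2r ?invr_gt0//.
rewrite -opprD normrN; apply: le_trans hprod.
exact: ler_pM.
Qed.

Variable nu : probability R R.
Local Notation F z := (reciprocal_cauchy_transform nu z).

(** In the variable [x = 2 sin t] the factor [cos t] lost in the stability bound
    is half the Jacobian, which removes the degeneracy at the edges. *)
Lemma smoothed_cdf_local_law (v e : R) : 0 < v ->
  (forall u, `|u| <= 2 -> 0 < complex.Im (F (u +i* v)) /\
     cmod (u +i* v - (F (u +i* v) + (F (u +i* v))^-1)) <= e) ->
  forall x y, `|x| <= 2 -> `|y| <= 2 ->
  `|smoothed_cdf nu v x - semicircle_cdf x -
    (smoothed_cdf nu v y - semicircle_cdf y)| <= 2 * (v + e).
Proof.
move=> v0 hF.
have pi0 := pi_gt0 R.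
have ve0 : 0 <= v + e.
  have [|_ /(le_trans (cmod_ge0 _))] := hF 0; first by rewrite normr0.
  by move: v0; lra.
pose f t := smoothed_cdf nu v (2 * sin t) - semicircle_cdf (2 * sin t).
pose df t := (- complex.Im (cauchy_transform nu ((2 * sin t) +i* v)) / pi -
   semicircle_pdf (2 * sin t)) * (2 * cos t).
have d_sin (t : R) : is_derive t (1 : R) (fun t => 2 * sin t) (2 * cos t).
  by apply: is_deriveZ.
have d_f (t : R) : is_derive t (1 : R) f (df t).
  have dQ := is_derive_smoothed_cdf nu (2 * sin t) v0.
  have dW := is_derive_semicircle_cdf (2 * sin t).
  have d1 := @is_derive1_comp _ _ (fun t => 2 * sin t) _ _ _ dQ (d_sin t).
  have d2 := @is_derive1_comp _ _ (fun t => 2 * sin t) _ _ _ dW (d_sin t).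
  rewrite /df mulrBl; exact: is_deriveB.
have df_le t : - (pi / 2) <= t <= pi / 2 -> `|df t| <= 2 * (v + e) / pi.
  move=> tpi; have c0 : 0 <= cos t by exact: cos_ge0_pihalf.
  have [|ImF hE] := hF (2 * sin t).
    rewrite normrM ger0_norm// -[leRHS]mulr1 ler_pM2l// ler_norml sin_geN1 sin_le1//.
  rewrite invrK in hE; have := semicircle_stability v0 c0 ImF.
  rewrite invrK /df normrM (ger0_norm (_ : 0 <= 2 * cos t)) ?mulr_ge0//.
  set a := `|_|; set b := cmod _ in hE * => h.
  rewrite mulrCA -[leRHS]mulrA ler_pM2l// (le_trans h)//.
  by rewrite ler_pM2r ?invr_gt0// lerD2l.
have cf : continuous f.
  move=> t; apply/differentiable_continuous/derivable1_diffP.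
  by have [] := d_f t.
have main s t : - (pi / 2) <= s -> s <= t -> t <= pi / 2 ->
    `|f t - f s| <= 2 * (v + e).
  move=> s1 st t1.
  have dfo z : z \in `]s, t[ -> is_derive z (1 : R) f (df z) by move=> _; exact: d_f.
  have cfw : {within `[s, t], continuous f} by exact: continuous_subspaceT.
  have [c] := MVT_segment st dfo cfw.
  rewrite in_itv/= => /andP[sc ct] ->.
  have cpi : - (pi / 2) <= c <= pi / 2 by apply/andP; split; lra.
  rewrite normrM (@ger0_norm _ (t - s)) ?subr_ge0//.
  apply: (@le_trans _ _ (2 * (v + e) / pi * pi)).
    apply: ler_pM => //; [by rewrite subr_ge0|exact: df_le|lra].
  by rewrite divfK// gt_eqF.
have sinK x : `|x| <= 2 -> exists2 t, - (pi / 2) <= t <= pi / 2 & 2 * sin t = x.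
  move=> x2; have x21 : -1 <= x / 2 <= 1.
    by move: x2; rewrite ler_norml => /andP[? ?]; apply/andP; split; lra.
  exists (asin (x / 2)); first by rewrite asin_geNpi2// asin_lepi2.
  by rewrite asinK ?in_itv//=; field.
move=> x y /sinK[t /andP[t1 t2] <-] /sinK[s /andP[s1 s2] <-].
have [st|/ltW ts] := leP s t; first exact: main.
by rewrite distrC; exact: main.
Qed.

End stability.

(** * From the local law to the Kolmogorov distance *)

Section cdf_theory.
Context {R : realType} (nu : probability R R).

Lemma cdf_ge0 (x : R) : 0 <= cdf nu x. Proof. exact: fine_ge0. Qed.

Lemma cdfE (x : R) : nu `]-oo, x]%classic = (cdf nu x)%:E.
Proof. by rewrite /cdf fineK// fin_num_measure. Qed.

Lemma cdf_le1 (x : R) : cdf nu x <= 1.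
Proof. by rewrite -lee_fin -cdfE probability_le1. Qed.

Lemma le_cdf (x y : R) : x <= y -> cdf nu x <= cdf nu y.
Proof.
move=> xy; rewrite -lee_fin -!cdfE le_measure ?inE//.
by move=> t /=; rewrite !in_itv/= => /le_trans; apply.
Qed.

End cdf_theory.

Section kolmogorov_from_local_law.
Context {R : realType} (nu : probability R R).
Local Notation F z := (reciprocal_cauchy_transform nu z).

(** All estimates take place over [-2, 2]: as the semicircle law has no mass
    outside, closeness on [-2, 2] forces the tails of [nu] to be small. *)
Lemma kolmogorov_local_law (v e : R) : 0 < v ->
  (forall u w, `|u| <= 2 -> v <= w <= 2 * v -> 0 < complex.Im (F (u +i* w)) /\
     cmod (u +i* w - (F (u +i* w) + (F (u +i* w))^-1)) <= e) ->
  (forall u, `|u| <= 2 -> cmod (cauchy_transform nu (u +i* v)) <= 4) ->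
  (kolmogorov nu semicircle <= (20 * v + 6 * e)%:E)%E.
Proof.
move=> v0 hF hG; pose N x := cdf nu x - semicircle_cdf x.
have vv : v <= v <= 2 * v by apply/andP; split; lra.
have v2v : v <= 2 * v <= 2 * v by apply/andP; split; lra.
have l1 := smoothed_cdf_local_law v0 (fun u hu => hF u v hu vv).
have l2 := smoothed_cdf_local_law (mulr_gt0 (ltr0Sn R 1) v0) (fun u hu => hF u (2 * v) hu v2v).
have gap x : `|x| <= 2 ->
    `|2 * smoothed_cdf nu v x - smoothed_cdf nu (2 * v) x - cdf nu x| <= 6 * v.
  move=> x2; apply: le_trans (smoothed_cdf_gap nu x v0) _.
  have : - complex.Im (cauchy_transform nu (x +i* v)) <= 4.
    by apply: le_trans (hG x x2); apply: le_trans (ler_Im_cmod _); rewrite -normrN ler_norm.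
  by move=> h; have := ler_wpM2l (ltW v0) h; lra.
(* [N] is twice the error at scale [v], minus the error at scale [2 v], minus the
   gap; the increments add up to [4 (v + e) + 2 (2 v + e) + 12 v]. *)
have N_le x y : `|x| <= 2 -> `|y| <= 2 -> N x - N y <= 20 * v + 6 * e.
  move=> x2 y2; move: (l1 x y x2 y2) (l2 x y x2 y2) (gap x x2) (gap y y2).
  by rewrite /N !ler_norml => /andP[? ?] /andP[? ?] /andP[? ?] /andP[? ?]; lra.
have m2 : `|- 2 : R| <= 2 by rewrite normrN ger0_norm.
have p2 : `|2 : R| <= 2 by rewrite ger0_norm.
have Wl := @semicircle_cdf_left R; have Wr := @semicircle_cdf_right R.
have N1 : 0 <= N (- 2) by rewrite /N Wl// subr0 cdf_ge0.
have N2 : N 2 <= 0 by rewrite /N Wr// subr_le0 cdf_le1.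
have N12 := N_le _ _ m2 p2.
have Nx x : `|N x| <= 20 * v + 6 * e.
  rewrite ler_norml; have [x2|x2] := leP `|x| 2.
    have := N_le _ _ x2 p2; have := N_le _ _ m2 x2.
    by move=> h1 h2; apply/andP; split; lra.
  move: x2; rewrite lter_normr => /orP[x2|x2].
    have x2' := ltW x2; have := le_cdf nu x2'; have := cdf_le1 nu x.
    move: N1 N2 N12; rewrite /N (Wr 2)// (Wr x)//.
    by move=> ? ? ? ? ?; apply/andP; split; lra.
  have x2' : x <= - 2 by lra.
  have := le_cdf nu x2'; have := cdf_ge0 nu x.
  move: N1 N2 N12; rewrite /N (Wl (- 2))// (Wl x)//.
  by move=> ? ? ? ? ?; apply/andP; split; lra.
apply: ge_ereal_sup => _ [x _ <-].
by rewrite !cdfE -EFinB lee_fin; exact: Nx.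
Qed.

End kolmogorov_from_local_law.

(** * Fourth moments on the sphere *)

Section uniform_sphere.
Context {R : realType} (n : nat) (sigma : probability (n.-tuple R) R).
Hypothesis sigmaU : uniform_on_sphere sigma.
Implicit Types theta : n.-tuple R.

Lemma measurable_fun_tuple_sum (f : 'I_n -> n.-tuple R -> R) :
  (forall i, measurable_fun setT (f i)) ->
  measurable_fun setT (fun theta => \sum_(i < n) f i theta).
Proof. by move=> mf; apply: measurable_sum. Qed.

Lemma measurable_tnthX (i : 'I_n) k :
  measurable_fun setT (fun theta => tnth theta i ^+ k).
Proof. by apply: measurable_funX; exact: measurable_tnth. Qed.

Lemma measurable_sphere : measurable (sphere R n).
Proof.
rewrite (_ : sphere R n =
    (fun theta => \sum_(i < n) tnth theta i ^+ 2) @^-1` [set 1])//.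
rewrite -[X in measurable X]setTI.
apply: (measurable_fun_tuple_sum _) => // i; exact: measurable_tnthX.
Qed.

Lemma measurable_orthogonal_act (Q : 'M[R]_n) :
  measurable_fun setT (orthogonal_act Q).
Proof.
apply/measurable_fun_tnthP => i.
rewrite (_ : _ \o _ = (fun theta => \sum_(j < n) Q i j * tnth theta j)).
  apply: measurable_fun_tuple_sum => j; apply: measurable_funM => //.
  exact: measurable_tnth.
by apply/funext => theta /=; rewrite tnth_mktuple.
Qed.

Lemma mean_orthogonal_act (Q : 'M[R]_n) (f : n.-tuple R -> R) :
  Q *m Q^T = 1%:M -> measurable_fun setT f -> (forall theta, 0 <= f theta) ->
  \int[sigma]_theta f (orthogonal_act Q theta) = \int[sigma]_theta f theta.
Proof.
move=> QQ mf f0; have mQ := measurable_orthogonal_act Q.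
rewrite /Rintegral; congr fine.
rewrite -[LHS](@ge0_integral_pushforward _ _ _ _ _ _ mQ sigma setT (EFin \o f))//.
- by apply: eq_measure_integral => A mA _; exact: sigmaU.2.
- exact/measurable_EFinP.
- by move=> theta _; rewrite lee_fin.
Qed.

(** Equal to [1] on the sphere and everywhere the sum of the products [p i j]
    below, whose integrability therefore follows from that of [total]. *)
Let total theta : R := (\sum_(i < n) tnth theta i ^+ 2) ^+ 2.

Let measurable_total : measurable_fun setT total.
Proof.
apply: measurable_funX; apply: measurable_fun_tuple_sum => i.
exact: measurable_tnthX.
Qed.

Let total1 : ae_eq sigma setT (EFin \o total) (cst 1%E).
Proof.
exists (~` sphere R n); split; first exact: measurableC measurable_sphere.
  have := probability_setC sigma measurable_sphere.
  by rewrite sigmaU.1 subee.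
by move=> theta /= h sph; apply: h => _; rewrite /total sph expr1n.
Qed.

Let has_mean_total : has_mean sigma total.
Proof.
apply/integrableP; split; first exact/measurable_EFinP.
under eq_integral do rewrite /= ger0_norm ?sqr_ge0//.
rewrite (ae_eq_integral (cst 1%E))//; last exact/measurable_EFinP.
by rewrite integral_cst// mul1e (le_lt_trans (probability_le1 _ _))// ltry.
Qed.

Let mean_total : \int[sigma]_theta total theta = 1.
Proof.
rewrite /Rintegral (ae_eq_integral (cst 1%E))//; last exact/measurable_EFinP.
have -> : (\int[sigma]_x cst 1 x = 1)%E.
  by rewrite integral_cst// mul1e; exact: (probability_setT sigma).
by [].
Qed.

Let p (i j : 'I_n) theta : R := tnth theta i ^+ 2 * tnth theta j ^+ 2.

Let p_ge0 i j theta : 0 <= p i j theta.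
Proof. by rewrite mulr_ge0 ?sqr_ge0. Qed.

Let totalE theta : total theta = \sum_(i < n) \sum_(j < n) p i j theta.
Proof.
rewrite /total expr2 mulr_suml; apply: eq_bigr => i _.
by rewrite mulr_sumr.
Qed.

Let measurable_p i j : measurable_fun setT (p i j).
Proof. by apply: measurable_funM; exact: measurable_tnthX. Qed.

Let has_mean_p i j : has_mean sigma (p i j).
Proof.
apply: (has_mean_dom _ _ has_mean_total) => // theta.
rewrite ger0_norm// totalE (bigD1 i)//= (bigD1 j)//= -addrA lerDl.
by rewrite addr_ge0 ?sumr_ge0// => k _; rewrite sumr_ge0.
Qed.

(** With [a], [b] as chosen, the reflection in the hyperplane orthogonal to
    [a e_i + b e_j] maps the coordinates [(x, y)] to [(- x - y, y - x) / sqrt 2],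
    whose fourth powers add up to [(x^4 + y^4) / 2 + 3 x^2 y^2]. *)
Let mixed_moment i j : i != j ->
  \int[sigma]_theta p i i theta + \int[sigma]_theta p j j theta =
  6 * \int[sigma]_theta p i j theta.
Proof.
move=> ij.
pose k : R := Num.sqrt 2^-1.
have k2 : k ^+ 2 = 2^-1 by rewrite sqr_sqrtr.
have k0 : 0 <= k := sqrtr_ge0 _.
have k1 : k <= 1 by rewrite -(@ler_pXn2r _ 2)// ?nnegrE// k2 expr1n invf_le1// ler1n.
pose a := Num.sqrt (1 + k); pose b := Num.sqrt (1 - k).
have a2 : a ^+ 2 = 1 + k by rewrite sqr_sqrtr// addr_ge0.
have b2 : b ^+ 2 = 1 - k by rewrite sqr_sqrtr// subr_ge0.
have ab : a * b = k.
  rewrite -sqrtrM ?addr_ge0// (_ : _ * _ = k ^+ 2) ?sqrtr_sqr ?ger0_norm//.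
  by rewrite mulrC -subr_sqr expr1n k2; lra.
pose u : 'rV[R]_n := \row_l (a * (l == i)%:R + b * (l == j)%:R).
have ui : u 0 i = a by rewrite mxE eqxx (negbTE ij) mulr1 mulr0 addr0.
have uj : u 0 j = b by rewrite mxE eqxx eq_sym (negbTE ij) mulr1 mulr0 add0r.
have u_sum (g : 'I_n -> R) : \sum_l u 0 l * g l = a * g i + b * g j.
  rewrite (bigD1 i)//= (bigD1 j) 1?eq_sym//= ui uj big1 ?addr0// => l /andP[li lj].
  by rewrite mxE (negbTE li) (negbTE lj) !mulr0 addr0 mul0r.
have uu : u *m u^T = 2%:M.
  apply/matrixP => x y; rewrite !ord1 !mxE eqxx mulr1n.
  under eq_bigr do rewrite [_^T _ _]mxE.
  rewrite u_sum ui uj -!expr2 a2 b2; lra.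
pose Q : 'M[R]_n := 1%:M - u^T *m u.
have QQ : Q *m Q^T = 1%:M.
  have -> : Q^T = Q by rewrite /Q linearB/= trmx_mul trmxK trmx1.
  have PP : (u^T *m u) *m (u^T *m u) = 2 *: (u^T *m u).
    by rewrite mulmxA -(mulmxA u^T u) uu mul_mx_scalar -scalemxAl.
  rewrite /Q mulmxBl mul1mx mulmxBr mulmx1 PP.
  by apply/matrixP => x y; rewrite !mxE; ring.
have Qact l theta : tnth (orthogonal_act Q theta) l =
    tnth theta l - u 0 l * (a * tnth theta i + b * tnth theta j).
  rewrite tnth_mktuple -u_sum mulr_sumr.
  transitivity (\sum_m ((l == m)%:R * tnth theta m - u 0 l * (u 0 m * tnth theta m))).
    apply: eq_bigr => m _; rewrite /Q !mxE big_ord1 !mxE; ring.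
  rewrite sumrB (bigD1 l)//= eqxx mul1r big1 ?addr0// => m ml.
  by rewrite eq_sym (negbTE ml) mul0r.
have fourth theta : p i i (orthogonal_act Q theta) + p j j (orthogonal_act Q theta) =
    2^-1 * (p i i theta + p j j theta) + 3 * p i j theta.
  rewrite /p !Qact ui uj; move: (tnth theta i) (tnth theta j) => x y.
  have -> : x - a * (a * x + b * y) = - k * (x + y).
    by rewrite mulrDr !mulrA -expr2 a2 ab; ring.
  have -> : y - b * (a * x + b * y) = k * (y - x).
    by rewrite mulrDr !mulrA -expr2 b2 [b * a]mulrC ab; ring.
  rewrite !exprMn sqrrN k2; by field.
have hii := has_mean_p i i; have hjj := has_mean_p j j; have hij := has_mean_p i j.
have inv : \int[sigma]_theta (p i i (orthogonal_act Q theta) + p j j (orthogonal_act Q theta)) =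
    \int[sigma]_theta (p i i theta + p j j theta).
  apply: (@mean_orthogonal_act Q (fun theta => p i i theta + p j j theta)) => //.
    exact: measurable_funD.
  by move=> th; rewrite addr_ge0.
move: inv; under eq_Rintegral do rewrite fourth.
have h1 := has_meanD hii hjj.
rewrite (meanD (has_meanZ 2^-1 h1) (has_meanZ 3 hij)) !meanZ// (meanD hii hjj).
lra.
Qed.

Let quarticE theta :
  \sum_(i < n) tnth theta i ^+ 4 = \sum_(i < n) p i i theta.
Proof. by apply: eq_bigr => i _; rewrite /p -exprD. Qed.

Lemma has_mean_quartic :
  has_mean sigma (fun theta => \sum_(i < n) tnth theta i ^+ 4).
Proof. by under eq_fun do rewrite quarticE; exact: has_mean_sum. Qed.

(** With [m i j] the mean of [theta_i^2 theta_j^2], the relation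
    [m i i + m j j = 6 m i j] for [i != j] is summed over all pairs and combined
    with [\sum_(i, j) m i j = 1]. *)
Lemma mean_quartic :
  \int[sigma]_theta \sum_(i < n) tnth theta i ^+ 4 = 3 / (n%:R + 2).
Proof.
under eq_Rintegral do rewrite quarticE.
rewrite mean_sum//; pose m i j := \int[sigma]_theta p i j theta.
have sum1 : \sum_(i < n) \sum_(j < n) m i j = 1.
  rewrite -mean_total; under [RHS]eq_Rintegral do rewrite totalE.
  rewrite mean_sum => [|i]; last exact: has_mean_sum.
  by apply: eq_bigr => i _; rewrite mean_sum.
have n2 : (n%:R + 2 : R) != 0 by rewrite gt_eqF// ltr_wpDl.
apply: (mulIf n2); rewrite divfK//.
suff : \sum_(i < n) \sum_(j < n) (m i i + m j j) =
       6 * \sum_(i < n) \sum_(j < n) m i j - 4 * \sum_(i < n) m i i.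
  rewrite sum1; under eq_bigr do rewrite big_split/= sumr_const card_ord.
  rewrite big_split/= sumr_const card_ord sumrMnl -mulr_natl.
  by move: (\sum_(i < n) m i i) => S; lra.
rewrite !mulr_sumr -sumrB; apply: eq_bigr => i _.
rewrite mulr_sumr (bigD1 i)//= [in RHS](bigD1 i)//=.
rewrite (eq_bigr (fun j => 6 * m i j)) => [|j ji]; first by ring.
by rewrite mixed_moment// eq_sym.
Qed.

(** Markov's inequality, the mean being [3 / (n + 2) <= 3 / n]. *)
Lemma sphere_quartic_small (rho : R) : 0 < rho -> (0 < n)%N ->
  let F := [set theta | sphere R n theta /\
                        \sum_(i < n) tnth theta i ^+ 4 <= 3 / (rho * n%:R)] in
  measurable F /\ ((1 - rho)%:E <= sigma F)%E.
Proof.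
move=> rho0 n0 F; set c := 3 / _ in F *.
have nR : 0 < n%:R :> R by rewrite ltr0n.
have c0 : 0 < c by rewrite divr_gt0// mulr_gt0.
pose A := [set theta : n.-tuple R | c < \sum_(i < n) tnth theta i ^+ 4].
have mq : measurable_fun setT (fun theta => \sum_(i < n) tnth theta i ^+ 4).
  by apply: measurable_fun_tuple_sum => i; exact: measurable_tnthX.
have mA : measurable A.
  rewrite (_ : A = (fun theta => \sum_(i < n) tnth theta i ^+ 4) @^-1` `]c, +oo[%classic).
    by rewrite -[X in measurable X]setTI; exact: mq.
  by apply/seteqP; split => theta /=; rewrite in_itv/= andbT.
have FE : F = sphere R n `\` A.
  by apply/seteqP; split => theta [? h]; split => //; move: h; rewrite /A/= leNgt => /negP.
have mF : measurable F by rewrite FE; apply: measurableD => //; exact: measurable_sphere.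
split => //.
have A_le : fine (sigma A) <= rho.
  have hA : has_mean sigma (\1_A : n.-tuple R -> R).
    apply: (@has_mean_bounded _ _ _ _ 1) => [|theta]; first exact: measurable_indic.
    by rewrite indicE; case: (_ \in _); rewrite ?normr1 ?normr0.
  have := le_mean (has_meanZ c hA) has_mean_quartic.
  rewrite meanZ// mean_quartic.
  rewrite [X in c * X](_ : _ = fine (sigma A)); last first.
    by rewrite /Rintegral integral_indic// setIT.
  have q0 theta : 0 <= \sum_(i < n) tnth theta i ^+ 4.
    by rewrite sumr_ge0// => i _; rewrite exprn_even_ge0.
  have hle theta : c * \1_A theta <= \sum_(i < n) tnth theta i ^+ 4.
    rewrite indicE; have [|_] := boolP (theta \in A); last by rewrite mulr0.
    by rewrite inE /A/= mulr1 => /ltW.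
  move=> /(_ hle) h.
  have : c * fine (sigma A) <= c * rho.
    apply: (le_trans h); rewrite /c mulrAC invfM mulrA mulfK ?gt_eqF//.
    by rewrite ler_pM2l// lef_pV2 ?posrE// ?lerDl// addr_gt0.
  by rewrite ler_pM2l.
have : (sigma (sphere R n) <= sigma F + sigma A)%E.
  rewrite (le_trans _ (measureU2 _ mF mA))//; apply: le_measure; rewrite ?inE.
  - exact: measurable_sphere.
  - exact: measurableU.
  - by move=> theta ?; have [|] := pselect (A theta); [right|left; rewrite FE].
rewrite sigmaU.1; have Ff : sigma F \is a fin_num := fin_num_measure _ _ mF.
have Af : sigma A \is a fin_num := fin_num_measure _ _ mA.
rewrite -(fineK Ff) -(fineK Af) -EFinD !lee_fin; move: A_le; lra.
Qed.

End uniform_sphere.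

(** * The rate of convergence *)

Section moments_of_hypotheses.
Context {R : realType} (mu : probability R R).
Hypothesis E0 : ('E_mu[idfun] = 0)%E.
Hypothesis V1 : ('V_mu[idfun] = 1)%E.
Hypothesis E4 : ('E_mu[(fun x : R => x ^+ 4)%R] < +oo)%E.

Lemma fourth_moment_has_mean : has_mean mu (fun t : R => t ^+ 4).
Proof.
move: E4; rewrite unlock => h; apply/integrableP; split.
  by apply/measurable_EFinP; exact: measurable_funX.
under eq_integral do rewrite /= ger0_norm ?exprn_even_ge0//.
exact: h.
Qed.

Lemma centered_mean0 : \int[mu]_t t = 0.
Proof. by move: E0; rewrite unlock /Rintegral => ->. Qed.

Lemma unit_variance : \int[mu]_t t ^+ 2 = 1.
Proof.
move: V1; rewrite /variance unlock E0 /= unlock /Rintegral => h.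
have -> : (\int[mu]_t (t ^+ 2)%:E = 1)%E; last by [].
rewrite -h; apply: eq_integral => t _; congr EFin.
by transitivity ((t - 0) * (t - 0)) => //; rewrite subr0 expr2.
Qed.

End moments_of_hypotheses.

Section rate.
Context {R : realType} (mu : probability R R).
Hypothesis fourth_mean : has_mean mu (fun t : R => t ^+ 4).
Hypothesis mean0 : \int[mu]_t t = 0.
Hypothesis var1 : \int[mu]_t t ^+ 2 = 1.
Local Notation b3 := (abs_moment mu 3).
Local Notation b4 := (abs_moment mu 4).

(** At height [v = 8 lam] each weight satisfies [theta_i^2 <= v / 8] and the
    self-consistent equation has error [O(lam)].  The two smallness conditions on
    [lam] leave room below height [1] for the scale [2 v] and make this error less
    than [3 / 4], as the bootstrap requires. *)
Lemma kolmogorov_free_convolution (n : nat) (theta : 'I_n -> R)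
    (nu : probability R R) (lam : R) : (0 < n)%N -> 0 < lam ->
  \sum_(i < n) theta i ^+ 2 = 1 -> \sum_(i < n) theta i ^+ 4 <= lam ^+ 2 ->
  16 * lam <= 1 -> (12 + 32 * b4 + 128 * b3) * lam < 3 / 4 ->
  is_free_convolution (fun i => dilation (theta i) mu) nu ->
  (kolmogorov nu semicircle <= ((232 + 192 * b4 + 768 * b3) * lam)%:E)%E.
Proof.
move=> n0 lam0 th2 th4 lam16 small [Z [[ZU _ Zsum _] ZF]].
pose v := 8 * lam; pose e := (12 + 32 * b4 + 128 * b3) * lam.
have v0 : 0 < v by rewrite mulr_gt0.
have th_le i : theta i ^+ 2 <= v / 8.
  rewrite /v mulrAC mulfV// mul1r -(@ler_pXn2r _ 2)// ?nnegrE ?sqr_ge0 ?(ltW lam0)//.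
  rewrite -exprM; apply: le_trans th4; rewrite (bigD1 i)//= lerDl sumr_ge0// => j _.
  by rewrite exprn_even_ge0.
have th3 : \sum_(i < n) `|theta i| ^+ 3 <= lam.
  (* [2 lam |x|^3 <= lam^2 x^2 + x^4] summed over the weights. *)
  apply: (@le_trans _ _ (\sum_(i < n) (lam / 2 * theta i ^+ 2 + (2 * lam)^-1 * theta i ^+ 4))).
    apply: ler_sum => i _.
    have t2 : theta i ^+ 2 = `|theta i| ^+ 2 by rewrite real_normK ?num_real.
    have -> : theta i ^+ 4 = (theta i ^+ 2) ^+ 2 by rewrite -exprM.
    rewrite t2; move: `|theta i| (normr_ge0 (theta i)) => x x0.
    rewrite -subr_ge0.
    have -> : lam / 2 * x ^+ 2 + (2 * lam)^-1 * (x ^+ 2) ^+ 2 - x ^+ 3 =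
       (2 * lam)^-1 * (lam * x - x ^+ 2) ^+ 2 by field; rewrite gt_eqF.
    by rewrite mulr_ge0 ?sqr_ge0// invr_ge0 mulr_ge0// ltW.
  rewrite big_split/= -!mulr_sumr th2 mulr1.
  have : (2 * lam)^-1 * \sum_(i < n) theta i ^+ 4 <= (2 * lam)^-1 * lam ^+ 2.
    by rewrite ler_wpM2l// invr_ge0 mulr_ge0// ltW.
  have -> : (2 * lam)^-1 * lam ^+ 2 = lam / 2 by field; rewrite gt_eqF.
  lra.
pose F z := reciprocal_cauchy_transform nu z.
have ImF u w : 0 < w -> 0 < complex.Im (F (u +i* w)).
  move=> w0; pose i0 := Ordinal n0.
  have zU : upper_half_plane (u +i* w) by [].
  rewrite /F (ZF _ zU i0) /reciprocal_cauchy_transform cauchy_transform_dilation; last exact: ZU.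
  have [_ + _] := reciprocal_cauchy_bounds (has_mean_pow fourth_mean (isT : (2 <= 4)%N))
    mean0 var1 (theta i0) (ZU i0 _ zU).
  by apply: lt_le_trans; exact: ZU.
have equation u w : v <= w -> 4^-1 <= cmod (F (u +i* w)) ->
    cmod (u +i* w - (F (u +i* w) + (F (u +i* w))^-1)) <= e.
  move=> vw F4; have w0 : 0 < w := lt_le_trans v0 vw.
  have zU : upper_half_plane (u +i* w) by [].
  have sumZ : (0 < n)%N -> \sum_(j < n) Z j (u +i* w) - (u +i* w) =
      (n%:R - 1) * F (u +i* w).
    by move=> _; rewrite (Zsum _ zU (Ordinal n0)) -(ZF _ zU).
  have := self_consistent_equation fourth_mean mean0 var1
    (fun i => ZU i _ zU) sumZ (ZF _ zU) n0 v0 vw th2 th_le F4.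
  have h4 : (\sum_(i < n) theta i ^+ 4) / v <= lam / 8.
    rewrite ler_pdivrMr// (le_trans th4)// /v le_eqVlt; apply/orP; left.
    by apply/eqP; field.
  move=> /le_trans; apply; rewrite /e.
  move: b3 b4 (abs_moment_ge0 mu 3) (abs_moment_ge0 mu 4) => c3 c4 c3_ge0 c4_ge0.
  have c4' : 0 <= 96 + 256 * c4 by lra.
  have c3' : 0 <= 128 * c3 by lra.
  by have := ler_wpM2l c4' h4; have := ler_wpM2l c3' th3; lra.
have G4 u w : `|u| <= 2 -> v <= w <= 1 -> cmod (cauchy_transform nu (u +i* w)) <= 4.
  move=> u2; apply: (cmod_cauchy_le4 v0 u2) => w' /andP[vw' _] F' F4.
  exact: (le_lt_trans (equation u w' vw' F4)).
have v21 : 2 * v <= 1 by rewrite /v; lra.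
have -> : (232 + 192 * b4 + 768 * b3) * lam = 20 * v + 6 * e by rewrite /v /e; ring.
apply: kolmogorov_local_law => // [u w u2 /andP[vw w2v]|u u2].
  have w0 : 0 < w := lt_le_trans v0 vw.
  split; first exact: ImF.
  apply: equation => //; rewrite /F cmodV lef_pV2 ?posrE//.
    by apply: G4 => //; rewrite vw (le_trans w2v).
  rewrite cmod_gt0; have := upper_neq0 (ImF u w w0).
  by rewrite /F /reciprocal_cauchy_transform invr_eq0.
by apply: G4 => //; rewrite lexx/=; lra.
Qed.

End rate.

Theorem theorem1p1 (R : realType) :
  exists C : R -> R -> R -> R,
  forall (rho : R) (mu : probability R R),
    0 < rho < 1 ->
    ('E_mu[idfun] = 0)%E ->
    ('V_mu[idfun] = 1)%E ->
    ('E_mu[(fun x : R => x ^+ 4)%R] < +oo)%E ->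
    0 < C rho (abs_moment mu 3) (abs_moment mu 4) /\
    exists n_rho_mu : nat,
    forall n : nat, (0 < n)%N ->
    forall sigma : probability (n.-tuple R) R, uniform_on_sphere sigma ->
    exists F : set (n.-tuple R),
      [/\ measurable F,
          F `<=` sphere R n,
          ((1 - rho)%:E <= sigma F)%E &
          (n_rho_mu <= n)%N ->
          forall theta : n.-tuple R, F theta ->
          forall mu_theta : probability R R,
            is_free_convolution (fun i => dilation (tnth theta i) mu) mu_theta ->
            (kolmogorov mu_theta semicircle <=
             (C rho (abs_moment mu 3) (abs_moment mu 4) / Num.sqrt n%:R)%:E)%E].
Proof.
exists (fun rho b3 b4 => (232 + 192 * b4 + 768 * b3) * Num.sqrt (3 / rho)).
move=> rho mu /andP[rho0 _] E0 V1 E4.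
have b3_ge0 := abs_moment_ge0 mu 3; have b4_ge0 := abs_moment_ge0 mu 4.
have main := kolmogorov_free_convolution (fourth_moment_has_mean E4)
  (centered_mean0 E0) (unit_variance E0 V1).
move: (abs_moment mu 3) (abs_moment mu 4) b3_ge0 b4_ge0 main => b3 b4 b3_ge0 b4_ge0 main.
have tau0 : 0 < Num.sqrt (3 / rho) by rewrite sqrtr_gt0 divr_gt0.
cbv beta; set tau := Num.sqrt (3 / rho) in tau0 *.
have C0 : 0 < 232 + 192 * b4 + 768 * b3 by lra.
split; first exact: mulr_gt0 C0 tau0.
(* [tau / sqrt n] bounds the square root of the quartic sum, and [K <= sqrt n]
   implies both smallness conditions on it. *)
pose K := tau * (16 + 2 * (12 + 32 * b4 + 128 * b3)).
have K1 : 0 <= 16 + 2 * (12 + 32 * b4 + 128 * b3) by lra.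
have K0 : 0 <= K := mulr_ge0 (ltW tau0) K1.
exists (Num.bound (K ^+ 2)) => n n0 sigma sigmaU.
have nR : 0 < n%:R :> R by rewrite ltr0n.
have [mF sF] := sphere_quartic_small sigmaU rho0 n0.
set F := (X in measurable X) in mF sF; exists F; split => // [theta []//|].
move=> nbig theta [th2 th4] nu nu_conv.
set s := Num.sqrt n%:R; have s0 : 0 < s by rewrite sqrtr_gt0.
have Ks : K <= s.
  rewrite -(@ler_pXn2r _ 2) ?nnegrE ?(ltW s0)// sqr_sqrtr ?(ltW nR)//.
  apply: (le_trans (ltW (archi_boundP (sqr_ge0 K)))).
  by rewrite ler_nat.
have taus : tau / s * (16 + 2 * (12 + 32 * b4 + 128 * b3)) <= 1.
  by rewrite mulrAC ler_pdivrMr// mul1r.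
have ts0 : 0 < tau / s by rewrite divr_gt0.
have tb3 := mulr_ge0 (ltW ts0) b3_ge0; have tb4 := mulr_ge0 (ltW ts0) b4_ge0.
rewrite -mulrA; apply: (main n _ nu (tau / s) n0 ts0 th2 _ _ _ nu_conv).
- rewrite (le_trans th4)// exprMn exprVn !sqr_sqrtr ?(ltW nR) ?divr_ge0 ?(ltW rho0)//.
  by rewrite invfM mulrA.
- by move: taus; lra.
- by move: taus; lra.
Qed.
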